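(* Let $\gamma=N(0,1)$ be the standard Gaussian measure on $\mathbb{R}$ and $\gamma^\infty$ the product measure on $\mathbb{R}^\infty$. The near-action of the full orthogonal group $G=O(l^2)$ of the real Hilbert space $l^2$ (with the strong operator topology) on $(\mathbb{R}^\infty,\gamma^\infty)$ (the automorphism group of the Gaussian measure) is whirly.
   Context: Near-action: for a Polish group $G$ and a standard Borel space with a probability measure $(X,\mathcal{X},\mu)$, a near-action is a Borel map $G\times X\to X$, $(g,x)\mapsto gx$, such that (i) $ex=x$ for almost every $x$; (ii) for each pair $g,h\in G$, $g(hx)=(gh)x$ for almost every $x$ (the null set may depend on $g,h$); (iii) each $g\in G$ preserves $\mu$. Equivalently (identifying near-actions that agree a.e. for each $g$), it is a continuous homomorphism from $G$ to the Polish group $\mathrm{Aut}(X,\mathcal{X},\mu)$ of equivalence classes mod 0 of invertible measure preserving transformations, with neighborhood basis at the identity given by the sets $\{T:\mu(A\triangle TA)<\varepsilon\}$, $A\in\mathcal{X}$, $\varepsilon>0$ (and their finite intersections). For $B\in\mathcal{X}$, $gB$ denotes $\{x:g^{-1}x\in B\}$, defined mod 0. The Gaussian near-action: let $X=\mathbb{R}^\infty$ with its Borel $\sigma$-algebra $\mathcal{X}$, $\mu=\gamma^\infty$, and let $\zeta_1,\zeta_2,\dots$ be the coordinate functions on $X$; they are i.i.d. $N(0,1)$ under $\mu$. For $c=(c_1,c_2,\dots)\in l^2$ put $\zeta(c)=\sum_k c_k\zeta_k\in L^2(\mu)$. The near-action of $O(l^2)$ is determined by the requirement that $\zeta(gc)=\zeta(c)\circ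 g^{-1}$ almost everywhere, for all $c\in l^2$ and $g\in O(l^2)$. Whirly: a near-action of $G$ on $(X,\mathcal{X},\mu)$ is whirly if for all $A,B\in\mathcal{X}$ of positive measure, every neighborhood of $e$ in $G$ contains $g$ such that $\mu(A\cap gB)>0$. (Equivalently: for all such $A,B$, $\mu(A\cap gB)>0$ for all $g$ outside a meager subset of $G$.) *)

(* Defs.v *)
From HB Require Import structures.
From mathcomp Require Import all_boot all_order all_algebra.
From mathcomp Require Import all_classical all_reals all_analysis.
From mathcomp Require Import ring lra.

Set Implicit Arguments.
Unset Strict Implicit.
Unset Printing Implicit Defensive.

Import Order.TTheory GRing.Theory Num.Theory.
Import numFieldNormedType.Exports.

Local Open Scope classical_set_scope.
Local Open Scope ring_scope.

(* l^2, with indices starting at 0 *)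
Definition square_summable {R : realType} : {pred nat -> R} :=
  mem [set c : nat -> R | cvgn (series (fun k => c k ^+ 2))].

Lemma square_summableP {R : realType} (c : nat -> R) :
  reflect (cvgn (series (fun k => c k ^+ 2))) (c \in square_summable).
Proof. by apply: (iffP idP); rewrite inE. Qed.

Lemma square_summable_submod {R : realType} :
  submod_closed (@square_summable R).
Proof.
split=> [|a u v /square_summableP cu /square_summableP cv].
  apply/square_summableP; rewrite (_ : series _ = fun=> 0); first exact: is_cvg_cst.
  by apply/funext => n; rewrite /series /= big1// => i _; rewrite expr0n.
apply/square_summableP.
apply: (@series_le_cvg _ _ ((2 * a ^+ 2) *: (fun k => u k ^+ 2)
                           + 2 *: (fun k => v k ^+ 2))).
- by move=> n; exact: sqr_ge0.
- move=> n; rewrite !fctE /GRing.scale/=.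
  by have := sqr_ge0 a; have := sqr_ge0 (u n); have := sqr_ge0 (v n); nra.
- move=> n; rewrite !fctE /GRing.scale/= -subr_ge0.
  rewrite (_ : _ - _ = (a * u n - v n) ^+ 2); first exact: sqr_ge0.
  ring.
- by apply: is_cvg_seriesD; apply: is_cvg_seriesZ.
Qed.

HB.instance Definition _ (R : realType) :=
  GRing.isSubmodClosed.Build R (nat -> R) square_summable
    square_summable_submod.

Record l2 (R : realType) := L2 {
  l2_val :> nat -> R;
  l2P : l2_val \in square_summable }.

HB.instance Definition _ (R : realType) := [isSub for @l2_val R].
HB.instance Definition _ (R : realType) := [Choice of l2 R by <:].
HB.instance Definition _ (R : realType) :=
  [SubChoice_isSubLmodule of l2 R by <:].

Definition l2_dot {R : realType} (u v : l2 R) : R :=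
  limn (series (fun k => u k * v k)).

Definition l2_norm {R : realType} (u : l2 R) : R := Num.sqrt (l2_dot u u).

Section l2_theory.
Context {R : realType}.
Implicit Types u v w : l2 R.

Lemma l2_cvg_dot u v : cvgn (series (fun k => u k * v k)).
Proof.
apply: normed_cvg.
apply: (@series_le_cvg _ _ ((fun k => u k ^+ 2) + (fun k => v k ^+ 2))).
- by move=> n /=.
- by move=> n; rewrite !fctE addr_ge0 ?sqr_ge0.
- move=> n; rewrite !fctE /= -(real_normK (num_real (u n))).
  rewrite -(real_normK (num_real (v n))) normrM.
  have := sqr_ge0 (`|u n| - `|v n|); have := mulr_ge0 (normr_ge0 (u n)) (normr_ge0 (v n)).
  nra.
- by apply: is_cvg_seriesD; apply/square_summableP; exact: l2P.
Qed.

Lemma l2_dotC u v : l2_dot u v = l2_dot v u.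
Proof. by rewrite /l2_dot; under eq_fun do rewrite mulrC. Qed.

Lemma l2_dotDl u v w : l2_dot (u + v) w = l2_dot u w + l2_dot v w.
Proof.
rewrite /l2_dot -lim_seriesD; [|exact: l2_cvg_dot..].
by congr (limn (series _)); apply/funext => k; rewrite !fctE -mulrDl.
Qed.

Lemma l2_dotZl a u v : l2_dot (a *: u) v = a * l2_dot u v.
Proof.
rewrite /l2_dot -[RHS]lim_seriesZ; last exact: l2_cvg_dot.
by congr (limn (series _)); apply/funext => k; rewrite !fctE /GRing.scale/= mulrA.
Qed.

Lemma l2_sqr_le_dot u k : u k ^+ 2 <= l2_dot u u.
Proof.
apply: (@le_trans _ _ (series (fun k => u k * u k) k.+1)).
  rewrite /series/= big_nat_recr//= -expr2 lerDr sumr_ge0// => i _.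
  by rewrite -expr2 sqr_ge0.
apply: nondecreasing_cvgn_le; last exact: l2_cvg_dot.
apply/nondecreasing_seqP => n; rewrite /series/= big_nat_recr//= lerDl.
by rewrite -expr2 sqr_ge0.
Qed.

Lemma l2_dot_ge0 u : 0 <= l2_dot u u.
Proof. exact: le_trans (sqr_ge0 (u 0%N)) (l2_sqr_le_dot u 0%N). Qed.

Lemma l2_norm0_eq0 u : l2_norm u = 0 -> u = 0.
Proof.
move/eqP; rewrite sqrtr_eq0 => u0; apply/val_inj/funext => k /=.
apply/eqP; rewrite -sqrf_eq0 eq_le sqr_ge0 andbT.
exact: le_trans (l2_sqr_le_dot u k) u0.
Qed.

Lemma l2_normZ a u : l2_norm (a *: u) = `|a| * l2_norm u.
Proof.
rewrite /l2_norm l2_dotZl l2_dotC l2_dotZl mulrA -expr2.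
by rewrite sqrtrM ?sqr_ge0// sqrtr_sqr.
Qed.

Lemma l2_sqr_norm u : l2_norm u ^+ 2 = l2_dot u u.
Proof. by rewrite sqr_sqrtr// l2_dot_ge0. Qed.

Lemma l2_norm_gt0 u : u != 0 -> 0 < l2_norm u.
Proof.
move=> u0; rewrite lt_neqAle sqrtr_ge0 andbT eq_sym.
by apply: contra_neq u0 => /l2_norm0_eq0.
Qed.

Lemma l2_cauchy_schwarz u v : l2_dot u v <= l2_norm u * l2_norm v.
Proof.
have [->|u0] := eqVneq u 0.
  by rewrite -(scale0r 0) l2_dotZl mul0r mulr_ge0 ?sqrtr_ge0.
have [->|v0] := eqVneq v 0.
  by rewrite l2_dotC -(scale0r 0) l2_dotZl mul0r mulr_ge0 ?sqrtr_ge0.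
have := l2_dot_ge0 (l2_norm v *: u + (- l2_norm u) *: v).
rewrite !l2_dotDl !l2_dotZl ![l2_dot _ (_ + _)]l2_dotC !l2_dotDl !l2_dotZl.
rewrite (l2_dotC v u) -!l2_sqr_norm => h.
have uv := mulr_gt0 (l2_norm_gt0 u0) (l2_norm_gt0 v0).
rewrite -subr_ge0 -(pmulr_rge0 _ uv) -(pmulr_rge0 _ (ltr0Sn R 1)).
apply: (le_trans h); rewrite le_eqVlt; apply/orP; left; apply/eqP; ring.
Qed.

Lemma l2_normD u v : l2_norm (u + v) <= l2_norm u + l2_norm v.
Proof.
rewrite -ler_sqr ?nnegrE ?addr_ge0 ?sqrtr_ge0// l2_sqr_norm l2_dotDl.
rewrite ![l2_dot _ (_ + _)]l2_dotC !l2_dotDl (l2_dotC v u) sqrrD -!l2_sqr_norm.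
have := l2_cauchy_schwarz u v; lra.
Qed.

End l2_theory.

HB.instance Definition _ (R : realType) :=
  Lmodule_isNormed.Build R (l2 R) l2_normD l2_normZ l2_norm0_eq0.

(* Boundedness and injectivity of the operator follow from orth_dot. *)
Record orthogonal_group (R : realType) := Orth {
  orth_fun :> l2 R -> l2 R;
  orth_linear : linear orth_fun;
  orth_dot : forall u v, l2_dot (orth_fun u) (orth_fun v) = l2_dot u v;
  orth_surj : forall v, exists u, orth_fun u = v }.

Section orthogonal_group.
Context {R : realType}.
Implicit Types g h : orthogonal_group R.

Lemma orth_eqP g h : (g : l2 R -> l2 R) =1 h -> g = h.
Proof.
case: g h => [f lf df sf] [f' lf' df' sf'] /= /funext ff'.
subst f'; congr Orth; exact: Prop_irrelevance.
Qed.

HB.instance Definition _ := gen_eqMixin (orthogonal_group R).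
HB.instance Definition _ := gen_choiceMixin (orthogonal_group R).

Lemma orthB g u v : g (u - v) = g u - g v.
Proof. by rewrite -scaleN1r addrC orth_linear scaleN1r addrC. Qed.

Lemma orth_norm g u : `|g u| = `|u|.
Proof. by rewrite /Num.norm /= /l2_norm orth_dot. Qed.

Lemma orth_inj g : injective g.
Proof.
move=> u v guv; apply/eqP; rewrite -subr_eq0 -normr_eq0 -(orth_norm g) orthB.
by rewrite guv subrr normr0.
Qed.

Definition orth_one : orthogonal_group R.
Proof. by apply: (@Orth _ id) => // v; exists v. Defined.

Definition orth_mul g h : orthogonal_group R.
Proof.
apply: (@Orth _ (g \o h)) => [a u v|u v|v] /=.
- by rewrite !orth_linear.
- by rewrite !orth_dot.
- have [w <-] := orth_surj g v; have [u <-] := orth_surj h w.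
  by exists u.
Defined.

Definition orth_inv_fun g v : l2 R := sval (cid (orth_surj g v)).

Lemma orth_inv_funK g : cancel (orth_inv_fun g) g.
Proof. by move=> v; rewrite /orth_inv_fun; case: cid. Qed.

Definition orth_inv g : orthogonal_group R.
Proof.
apply: (@Orth _ (orth_inv_fun g)) => [a u v|u v|v].
- by apply: (@orth_inj g); rewrite orth_linear !orth_inv_funK.
- by rewrite -(orth_dot g) !orth_inv_funK.
- by exists (g v); apply: (@orth_inj g); rewrite orth_inv_funK.
Defined.

Lemma orth_mulA : associative orth_mul.
Proof. by move=> g h k; apply: orth_eqP. Qed.

Lemma orth_mul1 : left_id orth_one orth_mul.
Proof. by move=> g; apply: orth_eqP. Qed.

Lemma orth_mulr1 : right_id orth_one orth_mul.
Proof. by move=> g; apply: orth_eqP. Qed.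

Lemma orth_mulV : left_inverse orth_one orth_inv orth_mul.
Proof.
by move=> g; apply: orth_eqP => v; apply: (@orth_inj g); rewrite /= orth_inv_funK.
Qed.

Lemma orth_mulrV : right_inverse orth_one orth_inv orth_mul.
Proof. by move=> g; apply: orth_eqP => v; rewrite /= orth_inv_funK. Qed.

HB.instance Definition _ := isGroup.Build (orthogonal_group R)
  orth_mulA orth_mul1 orth_mulr1 orth_mulV orth_mulrV.

HB.instance Definition _ := isPointed.Build (orthogonal_group R) 1%g.

(* The strong operator topology is the topology of pointwise convergence, l^2
   carrying its norm topology. *)
HB.instance Definition _ := Topological.copy (orthogonal_group R)
  (initial_topology (@orth_fun R : _ -> {ptws l2 R -> l2 R})).

End orthogonal_group.

HB.mixin Record isTopologicalGroup G of Group G & Topological G := {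
  mulg_continuous : continuous (fun gh : G * G => (gh.1 * gh.2)%g);
  invg_continuous : continuous (fun g : G => (g^-1)%g) }.

#[short(type="topGroupType")]
HB.structure Definition TopGroup :=
  {G of isTopologicalGroup G & Group G & PointedTopological G}.

Section orth_topology.
Context {R : realType}.

Lemma orth_cvgP (F : set_system (orthogonal_group R)) (FF : Filter F)
    (g : orthogonal_group R) :
  F --> g <-> forall c : l2 R, (fun h : orthogonal_group R => h c) @ F --> g c.
Proof.
have -> : F --> g <-> (@orth_fun R : _ -> {ptws l2 R -> l2 R}) @ F -->
    (orth_fun g : {ptws l2 R -> l2 R}).
  split=> [Fg|Fg A].
    exact: (cvg_trans (cvg_app (@orth_fun R : _ -> {ptws l2 R -> l2 R}) Fg)
      (@initial_continuous _ _ (@orth_fun R : _ -> {ptws l2 R -> l2 R}) g)).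
  rewrite nbhsE => -[_ [[B oB <-] Bg] BA].
  apply: (filterS BA); apply: Fg; exact: open_nbhs_nbhs.
exact: (@pointwise_cvgP (l2 R) (l2 R) _ (orth_fun g)).
Qed.

Lemma orth_eval_cvg (g : orthogonal_group R) (c : l2 R) :
  (fun h : orthogonal_group R => h c) @ g --> g c.
Proof. by have /orth_cvgP : nbhs g --> g by []. Qed.

Lemma orth_mul_continuous : continuous
  (fun gh : orthogonal_group R * orthogonal_group R => (gh.1 * gh.2)%g).
Proof.
move=> [g0 h0] /=; apply/orth_cvgP => c; apply/cvgrPdist_lt => e e0.
have e2 : 0 < e / 2 by rewrite divr_gt0.
have /cvgrPdist_lt/(_ _ e2) Hg := @orth_eval_cvg g0 (h0 c).
have /cvgrPdist_lt/(_ _ e2) Hh := @orth_eval_cvg h0 c.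
exists ([set g : orthogonal_group R | `|g0 (h0 c) - g (h0 c)| < e / 2],
        [set h : orthogonal_group R | `|h0 c - h c| < e / 2]) => //=.
move=> [g h] /= [gP hP].
rewrite -(subrKA (g (h0 c))) (splitr e).
by rewrite (le_lt_trans (ler_normD _ _))// ltrD// -orthB orth_norm.
Qed.

Lemma orth_inv_continuous : continuous
  (fun g : orthogonal_group R => (g^-1)%g).
Proof.
move=> g0; have FF : Filter (nbhs (g0 : orthogonal_group R)).
  exact: (@nbhs_filter (orthogonal_group R)).
apply/orth_cvgP => c; apply/cvgrPdist_lt => e e0.
have /cvgrPdist_lt/(_ _ e0) := @orth_eval_cvg g0 ((g0^-1)%g c).
apply: filterS => g /=; rewrite orth_inv_funK distrC => gP.
by rewrite -(orth_norm g) orthB orth_inv_funK.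
Qed.

End orth_topology.

HB.instance Definition _ (R : realType) :=
  isTopologicalGroup.Build (orthogonal_group R)
    orth_mul_continuous orth_inv_continuous.

Definition Borel (T : ptopologicalType) := g_sigma_algebraType (@open T).

(* In the source G is Polish and X is standard Borel; neither property occurs in
   the clauses below, so these are stated for any topological group and any
   probability space. *)
Section near_action.
Context (G : topGroupType) d (X : measurableType d) (R : realType).
Variables (mu : probability X R) (a : G -> X -> X).

Record near_action : Prop := {
  near_action_measurable : measurable_fun [set: Borel G * X]
    (fun gx : Borel G * X => a gx.1 gx.2) ;
  near_action1 : {ae mu, forall x, a 1%g x = x} ;
  near_actionM : forall g h, {ae mu, forall x, a g (a h x) = a (g * h)%g x} ;
  near_action_preserving : forall g (A : set X), measurable A ->
    mu (a g @^-1` A) = mu A }.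

(* gB = {x | g^-1 x \in B}; it differs from the direct image of B under a g by a
   null set only, and a g need not be injective. *)
Definition translate (g : G) (B : set X) : set X := [set x | B (a g^-1%g x)].

Definition whirly := forall A B : set X, measurable A -> measurable B ->
  (0 < mu A)%E -> (0 < mu B)%E ->
  forall U : set G, nbhs 1%g U -> exists2 g, U g & (0 < mu (A `&` translate g B))%E.

End near_action.

(* R^\infty with the product topology; its Borel sigma-algebra is also the
   product sigma-algebra. *)
Definition Rinfty (R : realType) : Type := {ptws nat -> R}.

HB.instance Definition _ (R : realType) := Topological.on (Rinfty R).
HB.instance Definition _ (R : realType) :=
  isPointed.Build (Rinfty R) (fun=> 0).

Section gaussian.
Context {R : realType}.

(* mu is the infinite product of copies of gamma: these values on cylinders
   determine mu. *)
Definition is_product_measure (gamma : probability (measurableTypeR R) R)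
    (mu : probability (Borel (Rinfty R)) R) :=
  forall n (A : nat -> set R), (forall i, measurable (A i)) ->
    mu [set x | forall i, (i < n)%N -> A i (x i)] =
    (\prod_(i < n) gamma (A i))%E.

Variable mu : probability (Borel (Rinfty R)) R.

Definition zeta_sum (c : l2 R) (n : nat) (x : Borel (Rinfty R)) : R :=
  \sum_(k < n) c k * x k.

(* f is a version of zeta(c) = \sum_k c_k zeta_k, where zeta_k is the k-th
   coordinate function and the series converges in L^2(mu) *)
Definition is_zeta (c : l2 R) (f : Borel (Rinfty R) -> R) :=
  f \in Lfun mu 2%:E /\
  ('N[mu]_2%:E[EFin \o (fun x => zeta_sum c n x - f x)%R])%E @[n --> \oo]
    --> 0%E.

(* zeta (g c) = zeta c \o g^-1 almost everywhere, for all versions f of zeta c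
   and h of zeta (g c) *)
Definition gaussian_near_action
    (a : orthogonal_group R -> Borel (Rinfty R) -> Borel (Rinfty R)) :=
  near_action mu a /\
  forall (g : orthogonal_group R) (c : l2 R) f h,
    is_zeta c f -> is_zeta (g c) h ->
    {ae mu, forall x, h x = f (a g^-1%g x)}.

End gaussian.

(* Main.v *)
Require Import Defs.
From HB Require Import structures.
From mathcomp Require Import all_boot all_order all_algebra.
From mathcomp Require Import all_classical all_reals all_analysis measurable_realfun.
From mathcomp Require Import ring lra.

Set Implicit Arguments.
Unset Strict Implicit.
Unset Printing Implicit Defensive.

Import Order.TTheory GRing.Theory Num.Theory.
Import numFieldNormedType.Exports.

Local Open Scope classical_set_scope.
Local Open Scope ring_scope.

(** Let [U] be a neighbourhood of the identity and choose [N] such that [U]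
    contains, for every [M >= N], the orthogonal map that acts on each plane
    spanned by [e_i] and [e_(M+i)], [i < M], as a rotation: by a small angle if
    [i < N], by a right angle if [N <= i < M].  Such a map [g] moves only the
    tail of a vector by more than a little, so [N] can be found before [M].
    Under [g] the coordinates [N <= i < M] are replaced by fresh independent
    ones, while each of the first [N] gets a little independent Gaussian noise,
    whose density is bounded below on bounded sets.  Hence for events [A'], [B']
    that depend on the first [M] coordinates only and force the first [N] into
    [[-K, K]], one has [mu (A' & gB') >= k * mu A' * mu B'] with [k > 0]
    independent of [M].  Bounded parts of [A] and [B] are approximated by such
    events up to an error that is small compared with this [k]. *)

(** * Rotations of finitely many coordinate planes of [l2] *)

Lemma l2_linE {R : realType} a (u v : l2 R) k :
  (a *: u + v : l2 R) k = a * u k + v k.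
Proof. by []. Qed.

Section pair_rotation.
Context {R : realType}.
Variables (M : nat) (C D : nat -> R).
Hypothesis CD1 : forall i, C i ^+ 2 + D i ^+ 2 = 1.

(* Rotates the plane of coordinates k and M + k, for each k < M, by the angle of
   cosine C k and sine D' k; the inverse rotation is obtained with D' = - D. *)
Definition pair_rotation_seq (D' c : nat -> R) (k : nat) : R :=
  if (k < M)%N then C k * c k - D' k * c (M + k)%N
  else if (k < M + M)%N then D' (k - M)%N * c (k - M)%N + C (k - M)%N * c k
  else c k.

Lemma pair_rotation_seql D' c i : (i < M)%N ->
  pair_rotation_seq D' c i = C i * c i - D' i * c (M + i)%N.
Proof. by move=> iM; rewrite /pair_rotation_seq iM. Qed.

Lemma pair_rotation_seqr D' c i : (i < M)%N ->
  pair_rotation_seq D' c (M + i)%N = D' i * c i + C i * c (M + i)%N.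
Proof.
move=> iM; rewrite /pair_rotation_seq ltnNge leq_addr /= ltn_add2l iM.
by rewrite addKn.
Qed.

Lemma sum_pairs (F : nat -> R) (n : nat) : (M + M <= n)%N ->
  \sum_(0 <= k < n) F k =
  \sum_(i < M) (F i + F (M + i)%N) + \sum_(M + M <= k < n) F k.
Proof.
move=> Mn; rewrite (big_cat_nat _ Mn)//=; congr (_ + _).
rewrite big_mkord big_split_ord /= -big_split /=.
by apply: eq_bigr => i _.
Qed.

Lemma eq_limn (u v : nat -> R) (n0 : nat) :
  (forall n, (n0 <= n)%N -> u n = v n) -> cvgn v -> u @ \oo --> limn v.
Proof.
move=> uv cv; apply: cvg_trans cv; apply: near_eq_cvg.
by exists n0 => // n /= n0n; rewrite uv.
Qed.

(** Planar rotations preserve dot products. Only the squares of [D'] are constrained, so that the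
    same computation serves [D] and the inverse rotation [- D]. *)
Lemma pair_rotation_prod D' (DD : forall i, D' i ^+ 2 = D i ^+ 2)
    (u v : nat -> R) i : (i < M)%N ->
  pair_rotation_seq D' u i * pair_rotation_seq D' v i +
  pair_rotation_seq D' u (M + i)%N * pair_rotation_seq D' v (M + i)%N =
  u i * v i + u (M + i)%N * v (M + i)%N.
Proof.
move=> iM; rewrite !(pair_rotation_seql _ _ iM) !(pair_rotation_seqr _ _ iM).
have := CD1 i; rewrite -DD => CD.
rewrite -[RHS]mul1r -CD; ring.
Qed.

(** The comparison goes plane by plane, so a partial sum must contain both coordinates of every
    plane: hence the bound [M + M]. *)
Lemma series_pair_rotation D' (DD : forall i, D' i ^+ 2 = D i ^+ 2)
    (u v : nat -> R) n : (M + M <= n)%N ->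
  series (fun k => pair_rotation_seq D' u k * pair_rotation_seq D' v k) n =
  series (fun k => u k * v k) n.
Proof.
move=> Mn; rewrite /series /= !(@sum_pairs _ n)//; congr (_ + _).
  by apply: eq_bigr => i _; exact: pair_rotation_prod.
apply: eq_big_nat => k /andP[Mk _].
rewrite /pair_rotation_seq ltnNge (leq_trans _ Mk) ?leq_addr//=.
by rewrite ltnNge Mk.
Qed.

Lemma pair_rotation_square_summable D' (DD : forall i, D' i ^+ 2 = D i ^+ 2)
    (c : l2 R) : pair_rotation_seq D' c \in square_summable.
Proof.
apply/square_summableP; apply: cvgP.
apply: (eq_limn (n0 := (M + M)%N) _ (@l2_cvg_dot _ c c)) => n Mn.
by rewrite -(series_pair_rotation DD)//; under eq_fun do rewrite -expr2.
Qed.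

Definition pair_rotation_fun D' (DD : forall i, D' i ^+ 2 = D i ^+ 2)
  (c : l2 R) : l2 R := L2 (pair_rotation_square_summable DD c).

(** Reversing every angle undoes the rotation; this supplies the preimages for the surjectivity of
    [pair_rotation]. *)
Lemma pair_rotation_funK (DN : forall i, (- D i) ^+ 2 = D i ^+ 2) :
  cancel (pair_rotation_fun DN) (pair_rotation_fun (fun=> erefl)).
Proof.
move=> c; apply/val_inj/funext => k /=.
have [kM|Mk] := ltnP k M.
  rewrite !(pair_rotation_seql _ _ kM) !(pair_rotation_seqr _ _ kM).
  rewrite -[RHS]mul1r -(CD1 k); ring.
have [kM|MMk] := ltnP k (M + M); last first.
  by rewrite /pair_rotation_seq ltnNge Mk/= ltnNge MMk.
have -> : k = (M + (k - M))%N by rewrite subnKC.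
have iM : (k - M < M)%N by rewrite ltn_subLR.
rewrite !(pair_rotation_seqr _ _ iM) (pair_rotation_seql _ _ iM).
rewrite -[RHS]mul1r -(CD1 (k - M)); ring.
Qed.

Definition pair_rotation : orthogonal_group R.
Proof.
apply: (@Orth _ (pair_rotation_fun (fun=> erefl))) => [a u v|u v|v].
- apply/val_inj/funext => k /=.
  change (pair_rotation_seq D (a *: u + v) k =
    a * pair_rotation_seq D u k + pair_rotation_seq D v k).
  rewrite /pair_rotation_seq !l2_linE.
  case: ifP => _; first by ring.
  by case: ifP => // _; ring.
- apply: cvg_lim => //; apply: (eq_limn (n0 := (M + M)%N) _ (@l2_cvg_dot _ u v)) => n Mn.
  exact: series_pair_rotation.
- have DN i : (- D i) ^+ 2 = D i ^+ 2 by rewrite sqrrN.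
  by exists (pair_rotation_fun DN v); rewrite pair_rotation_funK.
Defined.

End pair_rotation.

(** * Rotations close to the identity in the strong operator topology *)

Section small_rotation.
Context {R : realType}.
Implicit Types c : l2 R.

Lemma series_sqr_le_dot c n : series (fun k => c k * c k) n <= l2_dot c c.
Proof.
apply: nondecreasing_cvgn_le; last exact: l2_cvg_dot.
apply/nondecreasing_seqP => m; rewrite /series/= big_nat_recr//= lerDl.
by rewrite -expr2 sqr_ge0.
Qed.

(* (small_cos n, small_sin n) are rational points of the circle tending to
   (1, 0). *)
Definition small_cos (n : nat) : R := (n.+1%:R ^+ 2 - 1) / (n.+1%:R ^+ 2 + 1).
Definition small_sin (n : nat) : R := 2 * n.+1%:R / (n.+1%:R ^+ 2 + 1).

Lemma small_cos_sin n : small_cos n ^+ 2 + small_sin n ^+ 2 = 1.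
Proof.
rewrite /small_cos /small_sin; have : 0 <= n.+1%:R ^+ 2 :> R by exact: sqr_ge0.
by move=> n0; field; lra.
Qed.

Lemma small_sin_gt0 n : 0 < small_sin n.
Proof. by rewrite /small_sin divr_gt0 ?mulr_gt0// ltr_wpDl// sqr_ge0. Qed.

(** [2 - 2 cos t] is the squared displacement of a unit vector rotated by the angle [t]; here it
    equals [4 / ((n+1)^2 + 1)], which is below [4 / (n+1)]. *)
Lemma cvg_small_cos : 2 - 2 * small_cos n @[n --> \oo] --> (0 : R).
Proof.
have h : 4 * harmonic n @[n --> \oo] --> (0 : R).
  rewrite -[X in _ --> X](mulr0 4); apply: cvgMl_tmp; exact: cvg_harmonic.
apply: (squeeze_cvgr _ (cvg_cst 0) h).
near=> n.
have -> : 2 - 2 * small_cos n = 4 / (n.+1%:R ^+ 2 + 1).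
  rewrite /small_cos; have : 0 <= n.+1%:R ^+ 2 :> R by exact: sqr_ge0.
  by move=> n0; field; lra.
have n1 : 1 <= n.+1%:R :> R by rewrite ler1n.
apply/andP; split; first by rewrite divr_ge0// addr_ge0// sqr_ge0.
have n2 : 0 < n.+1%:R ^+ 2 + 1 :> R by rewrite ltr_wpDl// sqr_ge0.
by rewrite ler_pM2l// lef_pV2 ?posrE//; nra.
Unshelve. all: by end_near. Qed.

(* For i < N the pair (c_i, c_(M+i)) is rotated by a small angle, and for
   N <= i < M by a right angle; the latter moves only the tail of c. *)
Definition rotation_cos N i : R := if (i < N)%N then small_cos N else 0.
Definition rotation_sin N i : R := if (i < N)%N then small_sin N else 1.

Lemma rotation_cos_sin N i : rotation_cos N i ^+ 2 + rotation_sin N i ^+ 2 = 1.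
Proof.
rewrite /rotation_cos /rotation_sin; case: ifP => _; first exact: small_cos_sin.
by rewrite expr0n expr1n add0r.
Qed.

Definition small_rotation N M : orthogonal_group R :=
  pair_rotation M (rotation_cos_sin N).

(** On each plane, rotation minus identity multiplies squared lengths by
    [(1 - C)^2 + D^2 = 2 - 2 C]; coordinates from [M + M] on do not move. *)
Lemma sqr_norm_pair_rotation M (C D : nat -> R)
    (CD : forall i, C i ^+ 2 + D i ^+ 2 = 1) c :
  `|pair_rotation M CD c - c| ^+ 2 =
  \sum_(i < M) (2 - 2 * C i) * (c i ^+ 2 + c (M + i)%N ^+ 2).
Proof.
have E k : (pair_rotation M CD c - c : l2 R) k =
    pair_rotation_seq M C D c k - c k by [].
rewrite {1}/Num.norm/=; move: (_ - c : l2 R) E => w E.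
rewrite l2_sqr_norm; apply: cvg_lim => //.
apply: cvg_near_cst.
exists (M + M)%N => // n /= Mn; rewrite /series /= (sum_pairs _ Mn).
rewrite [X in _ + X]big1_seq ?addr0; last first.
  move=> k; rewrite mem_index_iota => /= /andP[Mk _].
  rewrite E /pair_rotation_seq ltnNge (leq_trans _ Mk) ?leq_addr//=.
  by rewrite ltnNge Mk subrr mul0r.
apply: eq_bigr => i _; rewrite !E.
rewrite !(pair_rotation_seql _ _ _ (ltn_ord i)).
rewrite !(pair_rotation_seqr _ _ _ (ltn_ord i)).
have -> : 2 - 2 * C i = (1 - C i) ^+ 2 + D i ^+ 2.
  by have := CD i; lra.
ring.
Qed.

(** Planes with [i < N] contribute the small factor times at most the whole squared norm. The others
    contribute the factor 2, but both their coordinates have index at least [N], so they see only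
    the tail of [c]. The bound is free of [M]. *)
Lemma sqr_norm_small_rotation N M c : (N <= M)%N ->
  `|small_rotation N M c - c| ^+ 2 <= (2 - 2 * small_cos N) * l2_dot c c +
    2 * (l2_dot c c - series (fun k => c k * c k) N).
Proof.
move=> NM; rewrite sqr_norm_pair_rotation.
have cos0 : 0 <= 2 - 2 * small_cos N.
  have /(_ N) := small_cos_sin; have := sqr_ge0 (small_sin N); nra.
pose F k := if (k < N)%N then 0 else c k * c k.
apply: (@le_trans _ _ (\sum_(i < M)
  ((2 - 2 * small_cos N) * (c i * c i + c (M + i)%N * c (M + i)%N) +
   2 * (F i + F (M + i)%N)))).
  apply: ler_sum => i _; rewrite /rotation_cos /F.
  rewrite [(M + i < N)%N]ltnNge (leq_trans NM) ?leq_addr//=.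
  have := sqr_ge0 (c i); have := sqr_ge0 (c (M + i)%N); rewrite !expr2 => a b.
  by case: ifP => _; nra.
rewrite big_split/= -!mulr_sumr; apply: lerD.
  apply: ler_wpM2l => //; apply: le_trans (series_sqr_le_dot c (M + M)).
  by rewrite /series/= (@sum_pairs _ M)// big_geq// addr0.
apply: ler_wpM2l => //; rewrite lerBrDr.
apply: le_trans (series_sqr_le_dot c (M + M)).
have := @sum_pairs _ M F (M + M)%N (leqnn _).
rewrite [X in _ = _ + X -> _]big_geq// addr0 => <-.
have NMM : (N <= M + M)%N by rewrite (leq_trans NM)// leq_addr.
rewrite /series /= [leRHS](big_cat_nat (n := N))//=.
rewrite [X in X + _ <= _](big_cat_nat (n := N))//=.
rewrite [X in X + _ + _]big1_seq ?add0r; last first.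
  by move=> k; rewrite mem_index_iota /F; case: ltnP.
rewrite addrC; apply: lerD => //; apply: ler_sum_nat => k /andP[Nk _].
by rewrite /F ltnNge Nk.
Qed.

Lemma nbhs1_small_rotation (U : set (orthogonal_group R)) : nbhs 1%g U ->
  exists N, forall M, (N <= M)%N -> U (small_rotation N M).
Proof.
(* The maps with [n <= N <= M] generate a filter, so that convergence to 1 can be checked vector by
   vector; the displacement bound makes it uniform in [M]. *)
pose B n := [set g | exists N M, [/\ (n <= N)%N, (N <= M)%N &
  g = small_rotation N M]].
pose F : set_system (orthogonal_group R) := filter_from setT B.
have FF : Filter F.
  apply: filter_from_filter; first by exists 0%N.
  move=> m n _ _; exists (maxn m n) => // g [N [M [mnN NM ->]]].
  by split; exists N, M; split => //; move: mnN; rewrite geq_max => /andP[].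
have : F --> (1%g : orthogonal_group R).
  apply/orth_cvgP => c; apply/cvgrPdist_lt => e e0.
  have cvg0 : (2 - 2 * small_cos N) * l2_dot c c +
    2 * (l2_dot c c - series (fun k => c k * c k) N) @[N --> \oo] --> (0 : R).
    rewrite -[X in _ --> X](addr0 0); apply: cvgD.
      by rewrite -(mul0r (l2_dot c c)); apply: cvgMr_tmp; exact: cvg_small_cos.
    rewrite -[X in _ --> X](mulr0 2); apply: cvgMl_tmp.
    rewrite -(subrr (l2_dot c c)); apply: cvgB; first exact: cvg_cst.
    exact: l2_cvg_dot.
  have e2 : 0 < e ^+ 2 by rewrite exprn_gt0.
  have /cvgrPdist_lt/(_ _ e2)[n _ nP] := cvg0.
  exists n => // _ [N [M [nN NM ->]]] /=.
  rewrite distrC -ltr_sqr ?nnegrE ?(ltW e0)//.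
  apply: (le_lt_trans (sqr_norm_small_rotation c NM)).
  have := nP N nN; rewrite sub0r normrN; apply: le_lt_trans; exact: ler_norm.
move=> F1 /F1[n _ nU]; exists n => M nM; apply: nU.
by exists n, M.
Qed.

End small_rotation.

(** * Law and square integrability of the coordinates *)

Section gaussian_coordinates.
Context {R : realType}.
Local Notation lambda := (@lebesgue_measure R).

(** The Radon-Nikodym derivative and the explicit density have the same integral over every
    measurable set, hence agree almost everywhere and can be exchanged in the change of
    variables. *)
Lemma ge0_integral_normal_prob (m s : R) (f : measurableTypeR R -> \bar R) :
  measurable_fun setT f -> (forall x, 0 <= f x)%E ->
  (\int[normal_prob m s]_x f x =
   \int[lambda]_x (f x * (normal_pdf m s x)%:E))%E.
Proof.
move=> mf f0; have dom := @normal_prob_dominates R m s.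
rewrite -(Radon_Nikodym_SigmaFinite.change_of_variables dom)//.
have mpdf : measurable_fun setT (fun x => (normal_pdf m s x)%:E).
  by apply/measurable_EFinP; exact: measurable_normal_pdf.
have iRN := Radon_Nikodym_SigmaFinite.f_integrable dom.
apply: ae_eq_integral => //.
- by apply: emeasurable_funM => //; exact: measurable_int iRN.
- exact: emeasurable_funM.
- apply: ae_eqe_mul2l; apply: integral_ae_eq => // A _ mA.
  by rewrite -Radon_Nikodym_SigmaFinite.f_integral.
Qed.

(* x^2 exp(-x^2/2) <= 4 exp(-x^2/4), a multiple of the density of N(0,2). *)
Lemma normal_prob_sqr_lty :
  (\int[normal_prob (0 : R) 1]_x (x ^+ 2)%:E < +oo)%E.
Proof.
have msqr : measurable_fun setT (fun x : R => (x ^+ 2)%:E).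
  by apply/measurable_EFinP; exact: measurable_funX.
rewrite ge0_integral_normal_prob//; last by move=> x; rewrite lee_fin sqr_ge0.
pose s : R := Num.sqrt 2.
have s2 : s ^+ 2 = 2 by rewrite /s sqr_sqrtr.
have s0 : s != 0 by rewrite sqrtr_eq0 -ltNge.
(* With this ratio of normalising constants, [x^2] times the [N(0,1)] density is at most [k] times
   the [N(0,2)] density. *)
pose k := 4 * normal_peak 1 / normal_peak s.
have pks := @normal_peak_gt0 R s s0.
have pk1 := @normal_peak_gt0 R 1 (oner_neq0 R).
have k0 : 0 <= k by rewrite divr_ge0 ?mulr_ge0 ?ltW.
apply: (@le_lt_trans _ _ (\int[lambda]_x (k%:E * (normal_pdf 0 s x)%:E)))%E.
  apply: ge0_le_integral => //.
  - by move=> x _; rewrite -EFinM lee_fin mulr_ge0 ?sqr_ge0 ?normal_pdf_ge0.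
  - apply: emeasurable_funM => //.
    by apply/measurable_EFinP; exact: measurable_normal_pdf.
  - apply: emeasurable_funM => //.
    by apply/measurable_EFinP; exact: measurable_normal_pdf.
  move=> x _; rewrite -!EFinM lee_fin !normal_pdfE ?oner_neq0// /k.
  rewrite mulrCA -mulrA.
  rewrite [leRHS](_ : _ = normal_peak 1 * (4 * normal_fun 0 s x)); last first.
    by field; rewrite gt_eqF.
  rewrite ler_pM2l// /normal_fun !subr0 s2 expr1n.
  have -> : - x ^+ 2 / (1 *+ 2) = - (x ^+ 2 / 4) + - (x ^+ 2 / 4) by field.
  have -> : - x ^+ 2 / (2 *+ 2) = - (x ^+ 2 / 4) by field.
  rewrite expRD mulrA ler_pM2r ?expR_gt0// expRN ler_pdivrMr ?expR_gt0//.
  by have := expR_ge1Dx (x ^+ 2 / 4); lra.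
rewrite integralZl//=; last exact: integrable_normal_pdf.
by rewrite integral_normal_pdf mule1 ltry.
Qed.

(** Coordinates are continuous for pointwise convergence, so preimages of open intervals are open,
    hence Borel. *)
Lemma measurable_coord i :
  measurable_fun setT (fun x : Borel (Rinfty R) => x i : R).
Proof.
move=> _; apply: (measurability _ (RGenOpens.measurableE R)) => //.
move=> _ [_ [a [b ->] <-]]; rewrite setTI; apply: sub_sigma_algebra.
have /continuousP : continuous (fun x : {ptws nat -> R} => x i).
  move=> x; have : nbhs x --> x by [].
  by move/(@pointwise_cvgP nat R _ x); apply.
by apply; exact: interval_open.
Qed.

Variable mu : probability (Borel (Rinfty R)) R.
Hypothesis mu_prod : is_product_measure (normal_prob (0 : R) 1) mu.

Lemma coord_distribution i (A : set R) : measurable A ->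
  mu [set x | A (x i)] = normal_prob (0 : R) 1 A.
Proof.
move=> mA; pose B j := if j == i then A else setT.
have mB j : measurable (B j) by rewrite /B; case: ifP.
rewrite (_ : [set x | _] = [set x | forall j, (j < i.+1)%N -> B j (x j)]).
  rewrite (mu_prod _ mB) (bigD1 (Ordinal (ltnSn i)))//= {1}/B eqxx big1 ?mule1//.
  move=> j; rewrite -val_eqE /= /B => /negbTE ->; exact: probability_setT.
apply/seteqP; split => x /= => [Ax j _|/(_ i (ltnSn i))].
  by rewrite /B; case: eqP => // ->.
by rewrite /B eqxx.
Qed.

Lemma coord_Lfun2 i : (fun x : Borel (Rinfty R) => x i) \in Lfun mu 2%:E.
Proof.
rewrite inE; apply/andP; split; first by rewrite inE; exact: measurable_coord.
rewrite inE /= /finite_norm unlock; apply: poweR_lty.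
have msqr : measurable_fun [set: measurableTypeR R]
    (fun x : measurableTypeR R => (x ^+ 2)%:E).
  by apply/measurable_EFinP; exact: measurable_funX.
have mi : measurable_fun setT
  (fun x : Borel (Rinfty R) => x i : measurableTypeR R) := measurable_coord i.
rewrite (_ : (\int[mu]_x _)%E =
  (\int[mu]_x ((fun y : R => (y ^+ 2)%:E) \o (fun x : Borel (Rinfty R) => x i)) x)%E).
  rewrite -(ge0_integral_pushforward mi mu measurableT msqr).
    apply: le_lt_trans normal_prob_sqr_lty.
    rewrite le_eqVlt; apply/orP; left; apply/eqP.
    by apply: eq_measure_integral => A mA _; exact: coord_distribution.
  by move=> y _; rewrite lee_fin sqr_ge0.
apply: eq_integral => x _ /=; congr (_%:E).
by rewrite powR_mulrn// real_normK// num_real.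
Qed.

End gaussian_coordinates.

(** * The action on coordinates, read off from finitely supported vectors *)

Section zeta_of_finite_support.
Context {R : realType}.
Variable mu : probability (Borel (Rinfty R)) R.
Hypothesis mu_prod : is_product_measure (normal_prob (0 : R) 1) mu.

Lemma zeta_sum_Lfun2 (c : l2 R) n : zeta_sum c n \in Lfun mu 2%:E.
Proof.
have p1 : (1 <= 2%:E :> \bar R)%E by rewrite lee_fin ler1n.
have [L0 LD] := @Lfun_addr_closed _ _ _ mu 2%:E p1.
elim: n => [|n IHn].
  rewrite (_ : zeta_sum c 0 = 0)//; apply/funext => x.
  by rewrite /zeta_sum big_ord0.
rewrite (_ : zeta_sum c n.+1 = zeta_sum c n + (c n \o* (fun x => x n))).
  by apply: LD => //; apply: Lfun_scale; [rewrite ler1n|exact: coord_Lfun2].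
by apply/funext => x; rewrite /zeta_sum big_ord_recr/= fctE mulrC.
Qed.

(** From [m] on the partial sums no longer change, so the [L^2] error is eventually 0. This gives
    explicit versions to which the defining relation of the action applies. *)
Lemma is_zeta_finite_support (c : l2 R) m : (forall k, (m <= k)%N -> c k = 0) ->
  is_zeta mu c (zeta_sum c m).
Proof.
move=> c0; split; first exact: zeta_sum_Lfun2.
apply: cvg_near_cst; exists m => // n /= mn.
rewrite [X in ('N[_]_ _[X])%E](_ : _ = cst 0%E); first by rewrite Lnorm0.
apply/funext => x /=; rewrite /zeta_sum -!(big_mkord xpredT (fun k => c k * x k)).
rewrite (big_cat_nat (n := m))//= [X in _ + X - _]big1_seq ?addr0 ?subrr//.
by move=> k; rewrite mem_index_iota => /= /andP[mk _]; rewrite c0// mul0r.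
Qed.

Lemma delta_square_summable i :
  (fun k => (k == i)%:R : R) \in square_summable.
Proof.
apply/square_summableP/cvg_ex; exists 1; apply: cvg_near_cst.
exists i.+1 => // n /= iN; rewrite /series /= big_mkord.
rewrite (bigD1 (Ordinal iN))//= eqxx expr1n big1 ?addr0// => j.
by rewrite -val_eqE /= => /negbTE ->; rewrite expr0n.
Qed.

Definition l2_delta i : l2 R := L2 (delta_square_summable i).

Lemma zeta_sum_delta i n x : (i < n)%N -> zeta_sum (l2_delta i) n x = x i.
Proof.
move=> iN; rewrite /zeta_sum (bigD1 (Ordinal iN))//= eqxx mul1r.
rewrite big1 ?addr0// => j.
by rewrite -val_eqE /= => /negbTE ->; rewrite mul0r.
Qed.

Variable a : orthogonal_group R -> Borel (Rinfty R) -> Borel (Rinfty R).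
Hypothesis mu_a : gaussian_near_action mu a.

(** The vector [g e_i = C_i e_i + D_i e_(M+i)] has finite support, so the relation
    [zeta(g c) = zeta(c) o g^-1] at [c = e_i] becomes an explicit formula for coordinate [i] of
    [g^-1 x]. *)
Lemma rotation_coord M (C D : nat -> R)
    (CD : forall i, C i ^+ 2 + D i ^+ 2 = 1) i : (i < M)%N ->
  {ae mu, forall x, C i * x i + D i * x (M + i)%N =
    a (pair_rotation M CD)^-1%g x i}.
Proof.
move=> iM; set g := pair_rotation M CD.
have gE k : g (l2_delta i) k = (k == i)%:R * C i + (k == M + i)%N%:R * D i.
  rewrite /= /pair_rotation_seq.
  have [kM|Mk] := ltnP k M.
    have -> : (k == M + i)%N = false.
      by apply/negbTE; rewrite neq_ltn ltn_addr.
    have -> : (M + k == i)%N = false.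
      by apply/negbTE; rewrite neq_ltn ltn_addr// orbT.
    have [->|_] := eqVneq k i; rewrite /=; ring.
  have -> : (k == i) = false.
    by apply/negbTE; rewrite neq_ltn (leq_trans iM Mk) orbT.
  have [kMM|MMk] := ltnP k (M + M).
    have -> : (k == M + i)%N = (k - M == i)%N.
      by apply/eqP/eqP => [->|<-]; rewrite ?addKn ?subnKC.
    by have [<-|_] := eqVneq (k - M)%N i; rewrite /=; ring.
  have -> : (k == M + i)%N = false.
    by apply/negbTE; rewrite neq_ltn orbC (leq_trans _ MMk)// ltn_add2l.
  by rewrite !mul0r addr0.
have zf : is_zeta mu (l2_delta i) (zeta_sum (l2_delta i) i.+1).
  apply: is_zeta_finite_support => k ik /=.
  by rewrite gtn_eqF.
have zh : is_zeta mu (g (l2_delta i)) (zeta_sum (g (l2_delta i)) (M + M)).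
  apply: is_zeta_finite_support => k ik; rewrite gE !gtn_eqF ?mul0r ?addr0//.
    by rewrite (leq_trans _ ik)// ltn_add2l.
  by rewrite (leq_trans _ ik)// (leq_trans iM)// leq_addr.
have := mu_a.2 g (l2_delta i) _ _ zf zh.
apply: filterS => x; rewrite zeta_sum_delta// => <-.
have iMM : (i < M + M)%N by rewrite (leq_trans iM)// leq_addr.
have MiMM : (M + i < M + M)%N by rewrite ltn_add2l.
rewrite /zeta_sum.
rewrite (eq_bigr (fun k : 'I_(M + M) => C i * (l2_delta i k * x k) +
   D i * (l2_delta (M + i) k * x k))); last by move=> k _; rewrite gE /=; ring.
rewrite big_split /= -!mulr_sumr; congr (_ * _ + _ * _).
  exact/esym/(zeta_sum_delta x iMM).
exact/esym/(zeta_sum_delta x MiMM).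
Qed.

End zeta_of_finite_support.

(** * Independence of the coordinate pairs [(x_i, x_(M+i))] *)

Section pair_law.
Context {R : realType}.
Variable mu : probability (Borel (Rinfty R)) R.
Hypothesis mu_prod : is_product_measure (normal_prob (0 : R) 1) mu.
Local Notation gamma := (normal_prob (0 : R) 1).
Local Notation gamma2 := (gamma \x gamma)%E.

Definition coord_pair i j (x : Borel (Rinfty R)) :
  measurableTypeR R * measurableTypeR R := (x i, x j).

Lemma measurable_coord_pair i j : measurable_fun setT (coord_pair i j).
Proof. by apply/measurable_fun_pair; exact: measurable_coord. Qed.

HB.instance Definition _ i j :=
  isMeasurableFun.Build _ _ _ _ (coord_pair i j) (measurable_coord_pair i j).

Lemma measurable_coord_pair_preimage i j
    (Q : set (measurableTypeR R * measurableTypeR R)) :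
  measurable Q -> measurable [set x : Borel (Rinfty R) | Q (x i, x j)].
Proof.
by move=> mQ; rewrite -[X in measurable X]setTI; exact: measurable_coord_pair.
Qed.

(** Rectangles generate the plane sigma-algebra and are closed under intersection, and both sides
    are finite measures in [Q], so agreement on rectangles extends. This lets one plane constraint
    pass from rectangles to arbitrary measurable sets. *)
Lemma measure_coord_pair (E : set (Borel (Rinfty R))) i j : measurable E ->
  (forall S T : set (measurableTypeR R), measurable S -> measurable T ->
    mu (E `&` [set x | (S `*` T) (x i, x j)]) = (mu E * (gamma S * gamma T))%E) ->
  forall Q : set (measurableTypeR R * measurableTypeR R), measurable Q ->
    mu (E `&` [set x | Q (x i, x j)]) = (mu E * gamma2 Q)%E.
Proof.
move=> mE ST Q mQ.
have mEfin : mu E \is a fin_num by exact: fin_num_measure.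
have mE0 : 0 <= fine (mu E) by rewrite fine_ge0.
pose m2 := mscale (NngNum mE0) gamma2.
have m1E U : pushforward (mrestr mu mE) (coord_pair i j) U =
    mu (E `&` [set x | U (x i, x j)]) by rewrite /pushforward /mrestr setIC.
have m2E U : m2 U = (mu E * gamma2 U)%E by rewrite /m2 /mscale /= fineK.
rewrite -m1E -m2E.
apply: (measure_unique [set A `*` B | A in measurable & B in measurable]
  (fun=> setT)) => //.
- exact: measurable_prod_measurableType.
- move=> _ _ [A mA [B mB <-]] [A' mA' [B' mB' <-]].
  by rewrite -setXI; exists (A `&` A'); [exact: measurableI|
    exists (B `&` B'); [exact: measurableI|]].
- by move=> n; exists setT => //; exists setT => //; rewrite setXTT.
- by rewrite bigcup_const.
- move=> _ [A mA [B mB <-]].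
  apply: (etrans (m1E _)); rewrite ST //.
  by rewrite -(product_measure1E gamma gamma).
- move=> _; apply: (@le_lt_trans _ _ (mu E)); last by rewrite -ge0_fin_numE.
  apply: (le_trans (y := mu (E `&` setT))); last by rewrite setIT.
  by rewrite le_eqVlt; apply/orP; left; apply/eqP; exact: m1E.
Qed.

(** The formula is freed from rectangles one plane at a time: in [H k] the planes from [k] on still
    carry rectangles. [H 0] is the product measure itself, and [H M] gives the claim. *)
Lemma measure_coord_pairs M (Q : nat -> set (measurableTypeR R * measurableTypeR R)) :
  (forall i, measurable (Q i)) ->
  mu [set x | forall i, (i < M)%N -> Q i (x i, x (M + i)%N)] =
  (\prod_(i < M) gamma2 (Q i))%E.
Proof.
suff H k : (k <= M)%N ->
    forall Q : nat -> set (measurableTypeR R * measurableTypeR R),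
    (forall i, measurable (Q i)) ->
    (forall i, (k <= i)%N -> exists S T : set (measurableTypeR R),
      [/\ measurable S, measurable T & Q i = S `*` T]) ->
    mu [set x | forall i, (i < M)%N -> Q i (x i, x (M + i)%N)] =
    (\prod_(i < M) gamma2 (Q i))%E.
  (* [H M] asks for rectangles from [M] on; there the sets are replaced by the whole plane, which
     leaves the event unchanged. *)
  move=> mQ; pose Q' i := if (i < M)%N then Q i else setT `*` setT.
  have Q'E i : (i < M)%N -> Q' i = Q i by rewrite /Q' => ->.
  rewrite (eq_bigr (fun i : 'I_M => gamma2 (Q' i))); last first.
    by move=> i _; rewrite Q'E.
  rewrite -(H M)//.
  - congr (mu _); apply/seteqP; split => x /= h i iM.
      by rewrite Q'E//; exact: h.
    by rewrite -Q'E//; exact: h.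
  - by move=> i; rewrite /Q'; case: ifP => // _; exact: measurableX.
  - move=> i Mi; exists setT, setT; split => //.
    by rewrite /Q' ltnNge Mi.
elim: k => [_ {}Q mQ rQ|k IHk kM {}Q mQ rQ].
  have /choice[S /choice[T ST]] : forall i, exists S T : set (measurableTypeR R),
      [/\ measurable S, measurable T & Q i = S `*` T] by move=> i; exact: rQ.
  have mS i : measurable (S i) by have [] := ST i.
  have mT i : measurable (T i) by have [] := ST i.
  pose A j := if (j < M)%N then S j else T (j - M)%N.
  have mA j : measurable (A j) by rewrite /A; case: ifP.
  rewrite (_ : [set x | _] = [set x | forall j, (j < M + M)%N -> A j (x j)]).
    rewrite (mu_prod _ mA) big_split_ord /= -big_split /=.
    apply: eq_bigr => i _; rewrite /A ltn_ord ltnNge leq_addr /= addKn.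
    by have [_ _ ->] := ST i; rewrite product_measure1E.
  apply/seteqP; split => x /= h.
    move=> j jMM; rewrite /A; case: ltnP => jM.
      by have := h _ jM; have [_ _ ->] := ST j => -[].
    have jM' : (j - M < M)%N by rewrite ltn_subLR.
    by have := h _ jM'; have [_ _ ->] := ST (j - M)%N => -[]; rewrite /= subnKC.
  move=> i iM; have [_ _ ->] := ST i; split => /=.
    have iMM : (i < M + M)%N by rewrite (leq_trans iM)// leq_addr.
    by have := h i iMM; rewrite /A iM.
  have iMM : (M + i < M + M)%N by rewrite ltn_add2l.
  by have := h _ iMM; rewrite /A ltnNge leq_addr/= addKn.
pose upd U i := if i == k then U else Q i.
have mupd U : measurable U -> forall i, measurable (upd U i).
  by move=> mU i; rewrite /upd; case: ifP.
pose p := (\prod_(i < M | i != Ordinal kM) gamma2 (Q i))%E.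
have updE U : (\prod_(i < M) gamma2 (upd U i) = gamma2 U * p)%E.
  rewrite /p; move: (product_measure1 _ _) => nu.
  rewrite (bigD1 (Ordinal kM))//= {1}/upd eqxx; congr (_ * _)%E.
  by apply: eq_bigr => i; rewrite -val_eqE /upd /= => /negbTE ->.
(* Plane [k] is unconstrained in [E]. The induction hypothesis with a rectangle in plane [k] is the
   product rule that [measure_coord_pair] extends to [Q k]. *)
pose E := [set x : Borel (Rinfty R) |
  forall i, (i < M)%N -> upd setT i (x i, x (M + i)%N)].
have EU U : E `&` [set x | U (x k, x (M + k)%N)] =
    [set x | forall i, (i < M)%N -> upd U i (x i, x (M + i)%N)].
  apply/seteqP; split => x /=.
    move=> [Ex Ux] i iM; have := Ex i iM; rewrite /upd.
    by case: eqP => // ->.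
  move=> h; split; last by have := h k kM; rewrite /upd eqxx.
  by move=> i iM; have := h i iM; rewrite /upd; case: eqP.
have IHU (S T : set (measurableTypeR R)) : measurable S -> measurable T ->
    mu [set x | forall i, (i < M)%N -> upd (S `*` T) i (x i, x (M + i)%N)] =
    (gamma S * gamma T * p)%E.
  move=> mS mT; rewrite IHk ?updE ?product_measure1E//; first exact: ltnW.
    by apply: mupd; exact: measurableX.
  move=> i ki; rewrite /upd; case: eqP => [_|/eqP ik]; first by exists S, T.
  by apply: rQ; rewrite ltn_neqAle eq_sym ik.
have muE : mu E = p.
  by rewrite /E -setXTT IHU// !probability_setT !mul1e.
have mE : measurable E.
  rewrite (_ : E = \bigcap_(i in [set i | (i < M)%N])
      [set x | upd setT i (x i, x (M + i)%N)]); last first.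
    by apply/seteqP; split => x h i iM; exact: h.
  apply: bigcap_measurable => [|i iM]; first by exists k.
  by apply: measurable_coord_pair_preimage; exact: mupd.
have QE : Q = upd (Q k) by apply/funext => i; rewrite /upd; case: eqP => [->|].
rewrite [in LHS]QE -EU (measure_coord_pair (i := k) (j := (M + k)%N) mE)//.
  by rewrite muE muleC -updE -QE.
by move=> S T mS mT; rewrite EU IHU// muE muleC.
Qed.

End pair_law.

(** * A lower bound for skew rectangles under the planar Gaussian measure *)

Section gaussian_plane.
Context {R : realType}.
Local Notation gamma := (normal_prob (0 : R) 1).
Local Notation gamma2 := (gamma \x gamma)%E.
Local Notation lambda := (@lebesgue_measure R).

Definition affine_map (p D : R) : measurableTypeR R -> measurableTypeR R :=
  fun t => p + D * t.

Lemma measurable_affine_map p D : measurable_fun setT (affine_map p D).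
Proof.
have : measurable_fun setT (fun t : R => p + D * t).
  by apply: measurable_funD => //; apply: measurable_funM.
exact.
Qed.

HB.instance Definition _ p D :=
  isMeasurableFun.Build _ _ _ _ (affine_map p D) (measurable_affine_map p D).

Lemma measurable_affine_preimage p D (T : set (measurableTypeR R)) :
  measurable T -> measurable (affine_map p D @^-1` T).
Proof.
by move=> mT; rewrite -[X in measurable X]setTI; exact: measurable_affine_map.
Qed.

(** [D] times the image of [lambda] under the affine map agrees with [lambda] on half-open
    intervals, which determine Lebesgue measure. *)
Lemma lebesgue_affine_preimage (p D : R) (T : set (measurableTypeR R)) :
  0 < D -> measurable T ->
  (D%:E * lambda (affine_map p D @^-1` T))%E = lambda T.
Proof.
move=> D0 mT.
pose m_ := mscale (NngNum (ltW D0)) (pushforward lambda (affine_map p D)).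
pose m := m_ (measurable_affine_map p D).
have mE U : m U = (D%:E * lambda (affine_map p D @^-1` U))%E by [].
rewrite -mE; symmetry; apply: lebesgue_measure_unique => // _ [[a b] _ <-].
rewrite [RHS]mE.
rewrite (_ : affine_map p D @^-1` _ = `](a - p) / D, (b - p) / D]%classic).
  rewrite !lebesgue_measure_itv /= !lte_fin ltr_pM2r ?invr_gt0// ltrD2r.
  case: ifP => _; last by rewrite mule0.
  by rewrite -!EFinD -EFinM; congr (_%:E); field; rewrite gt_eqF.
apply/seteqP; split => t; rewrite /affine_map /= !in_itv /=.
  by rewrite ltr_pdivrMr// ler_pdivlMr// ltrBlDl lerBrDl (mulrC t).
by rewrite ltr_pdivrMr// ler_pdivlMr// ltrBlDl lerBrDl (mulrC t).
Qed.

Lemma normal_prob_ub (T : set (measurableTypeR R)) : measurable T ->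
  (gamma T <= (normal_peak 1)%:E * lambda T)%E.
Proof.
move=> mT; rewrite -integral_cst//.
apply: ge0_le_integral => //.
- by move=> x _; rewrite lee_fin normal_pdf_ge0.
- apply/measurable_EFinP/measurable_funTS; exact: measurable_normal_pdf.
- by move=> x _; rewrite lee_fin normal_pdf_ub// oner_neq0.
Qed.

Lemma normal_prob_lb (L : R) (T : set (measurableTypeR R)) : measurable T ->
  T `<=` `[- L, L]%classic ->
  ((normal_pdf 0 1 L)%:E * lambda T <= gamma T)%E.
Proof.
move=> mT TL; rewrite -integral_cst//.
apply: ge0_le_integral => //.
- by move=> x _; rewrite lee_fin normal_pdf_ge0.
- apply/measurable_EFinP/measurable_funTS; exact: measurable_normal_pdf.
move=> x /TL; rewrite /= in_itv /= => /andP[Lx xL].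
rewrite lee_fin !normal_pdfE ?oner_neq0// ler_wpM2l ?normal_peak_ge0//.
rewrite /normal_fun !subr0 ler_expR ler_wpM2r ?invr_ge0 ?mulrn_wge0 ?expr1n//.
by rewrite lerN2; nra.
Qed.

(** The plane event produced by a rotation: [S] constrains the coordinate itself, [T] the rotated
    coordinate of [rotation_coord]. *)
Definition skew_rectangle (C D : R) (S T : set (measurableTypeR R)) :
    set (measurableTypeR R * measurableTypeR R) :=
  [set st | S st.1 /\ T (C * st.1 + D * st.2)].

Lemma measurable_skew_rectangle C D S T : measurable S -> measurable T ->
  measurable (skew_rectangle C D S T).
Proof.
move=> mS mT.
have mf : measurable_fun [set: measurableTypeR R * measurableTypeR R]
    (fun st => C * st.1 + D * st.2 : measurableTypeR R).
  have : measurable_fun [set: R * R] (fun st => C * st.1 + D * st.2).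
    by apply: measurable_funD; apply: measurable_funM.
  exact.
rewrite (_ : skew_rectangle C D S T = (fst @^-1` S) `&`
   ((fun st => C * st.1 + D * st.2) @^-1` T))//.
apply: measurableI.
  by rewrite -[X in measurable X]setTI; exact: measurable_fst.
by rewrite -[X in measurable X]setTI; exact: mf.
Qed.

(** For fixed [s] in [S] the section is the preimage of [T] under [t -> C s + D t]. It stays in a
    bounded interval, where [gamma] is at least a multiple of Lebesgue measure, while [gamma T] is
    at most a multiple of it. Integration over [s] gives the bound. *)
Lemma gamma2_skew_lb (C D K : R) : 0 < D -> `|C| <= 1 ->
  exists2 k : R, 0 < k & forall S T : set (measurableTypeR R),
    measurable S -> measurable T ->
    S `<=` `[- K, K]%classic -> T `<=` `[- K, K]%classic ->
    (k%:E * (gamma S * gamma T) <=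
     gamma2 (skew_rectangle C D S T))%E.
Proof.
(* [C s + D t] and, as [|C| <= 1], also [C s] lie in [[-K, K]]; hence [|t| <= 2 K / D]. *)
move=> D0 C1; pose L := (K + K) / D.
have pdf0 : 0 < normal_pdf 0 1 L.
  by rewrite normal_pdfE ?oner_neq0// mulr_gt0 ?expR_gt0 ?normal_peak_gt0 ?oner_neq0.
have peak0 : 0 < normal_peak 1 :> R by rewrite normal_peak_gt0 ?oner_neq0.
(* The lower density bound over the upper one, with [D] for the change of scale. *)
pose k := normal_pdf 0 1 L / (D * normal_peak 1).
have k0 : 0 < k by rewrite divr_gt0// mulr_gt0.
exists k => // S T mS mT SK TK.
have section s : S s -> (k%:E * gamma T <= gamma (affine_map (C * s) D @^-1` T))%E.
  move=> Ss.
  apply: (le_trans (y := (k%:E * ((normal_peak 1)%:E * lambda T))%E)).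
    by rewrite lee_pmul2l//; exact: normal_prob_ub.
  rewrite -(lebesgue_affine_preimage (C * s) D0 mT) !muleA -!EFinM.
  rewrite (_ : k * normal_peak 1 * D = normal_pdf 0 1 L); last first.
    by rewrite /k; field; rewrite !gt_eqF.
  apply: normal_prob_lb; first exact: measurable_affine_preimage.
  move=> t /TK; have := SK _ Ss; rewrite /affine_map /= !in_itv /= -!ler_norml.
  move=> sK tK; rewrite ler_pdivlMr// -[X in _ * X]gtr0_norm// -normrM mulrC.
  rewrite (_ : D * t = (C * s + D * t) - C * s); last by ring.
  apply: (le_trans (ler_normB _ _)); apply: lerD => //.
  by rewrite normrM -[leRHS]mul1r ler_pM.
rewrite /product_measure1 /=.
have mQ := measurable_skew_rectangle C D mS mT.
have msec : measurable_fun [set: measurableTypeR R]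
  (gamma \o xsection (skew_rectangle C D S T)) := measurable_fun_xsection _ mQ.
apply: (@le_trans _ _ (\int[gamma]_(s in S) (k%:E * gamma T)))%E.
  by rewrite integral_cst//= -muleA (muleC (gamma S)).
apply: (@le_trans _ _ (\int[gamma]_(s in S)
   gamma (xsection (skew_rectangle C D S T) s)))%E.
  apply: ge0_le_integral => //.
  - by move=> s _; rewrite mule_ge0// lee_fin ltW.
  - exact: measurable_funTS.
  move=> s Ss; rewrite (_ : xsection _ _ = affine_map (C * s) D @^-1` T).
    exact: section.
  apply/seteqP; split => t; rewrite /xsection /skew_rectangle /= inE /=.
    by case.
  by split.
apply: ge0_subset_integral => //.
Qed.

End gaussian_plane.

(** * Cylinders and their translates under rotations *)

Lemma le_measure_ae d (T : measurableType d) (R : realType)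
    (mu : {measure set T -> \bar R}) (A B : set T) :
  measurable A -> measurable B -> {ae mu, forall x, A x -> B x} ->
  (mu A <= mu B)%E.
Proof.
move=> mA mB [N [mN N0 ABN]].
apply: (@le_trans _ _ (mu (B `|` N))).
  apply: le_measure; rewrite ?inE//; first exact: measurableU.
  move=> x Ax; have [Bx|nBx] := pselect (B x); first by left.
  by right; apply: ABN => /= /(_ Ax).
by apply: (le_trans (measureU2 _ mB mN)); rewrite [X in (_ + X)%E]N0 adde0.
Qed.

Section rotated_cylinders.
Context {R : realType}.
Variable mu : probability (Borel (Rinfty R)) R.
Hypothesis mu_prod : is_product_measure (normal_prob (0 : R) 1) mu.
Local Notation gamma := (normal_prob (0 : R) 1).
Local Notation gamma2 := (gamma \x gamma)%E.
Implicit Types (S T : nat -> set (measurableTypeR R)) (E F : set (Borel (Rinfty R))).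

Definition cylinder M S : set (Borel (Rinfty R)) :=
  [set x | forall i, (i < M)%N -> S i (x i)].

Lemma measurable_coord_preimage i (A : set (measurableTypeR R)) :
  measurable A -> measurable [set x : Borel (Rinfty R) | A (x i)].
Proof.
by move=> mA; rewrite -[X in measurable X]setTI; exact: measurable_coord.
Qed.

Lemma measurable_cylinder M S : (forall i, measurable (S i)) ->
  measurable (cylinder M S).
Proof.
move=> mS; rewrite (_ : cylinder M S =
    \bigcap_(i in [set i | (i < M)%N]) [set x | S i (x i)]); last first.
  by apply/seteqP; split => x h i iM; exact: h.
apply: bigcap_measurableType => i _; exact: measurable_coord_preimage.
Qed.

Variable a : orthogonal_group R -> Borel (Rinfty R) -> Borel (Rinfty R).
Hypothesis mu_a : gaussian_near_action mu a.

Lemma measurable_translate g E : measurable E -> measurable (translate a g E).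
Proof.
move=> mE; have ma := near_action_measurable mu_a.1.
have := measurableT_comp ma (pair1_measurable (g^-1%g : Borel (orthogonal_group R))).
by move=> /(_ measurableT _ mE); rewrite setTI.
Qed.

Lemma measure_translate g E : measurable E -> mu (translate a g E) = mu E.
Proof. exact: (near_action_preserving mu_a.1). Qed.

(** Almost everywhere, lying in the translate is a condition on the numbers [C i x_i + D i x_(M+i)].
    The intersection thus constrains each plane separately, and the planes are independent. *)
Lemma measure_cylinder_rotation M (C D : nat -> R)
    (CD : forall i, C i ^+ 2 + D i ^+ 2 = 1) S T :
  (forall i, measurable (S i)) -> (forall i, measurable (T i)) ->
  mu (cylinder M S `&` translate a (pair_rotation M CD) (cylinder M T)) =
  (\prod_(i < M) gamma2 (skew_rectangle (C i) (D i) (S i) (T i)))%E.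
Proof.
move=> mS mT; set g := pair_rotation M CD.
pose Q i := skew_rectangle (C i) (D i) (S i) (T i).
have mQ i : measurable (Q i) by exact: measurable_skew_rectangle.
have mcyl := measurable_cylinder M.
rewrite -(measure_coord_pairs mu_prod M mQ).
have ae_coord : {ae mu, forall x i, (i < M)%N ->
    C i * x i + D i * x (M + i)%N = a g^-1%g x i}.
  apply/ae_foralln => i; have [iM|Mi] := ltnP i M; last exact: aeW.
  apply: negligibleS (rotation_coord mu_prod mu_a CD iM) => x /= nxi xi.
  by apply: nxi => _.
have mE : measurable (cylinder M S `&` translate a g (cylinder M T)).
  apply: measurableI; first exact: measurable_cylinder.
  by apply: measurable_translate; exact: measurable_cylinder.
have mF : measurable [set x : Borel (Rinfty R) |
    forall i, (i < M)%N -> Q i (x i, x (M + i)%N)].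
  rewrite (_ : [set x | _] = \bigcap_(i in [set i | (i < M)%N])
      [set x | Q i (x i, x (M + i)%N)]); last first.
    by apply/seteqP; split => x h i iM; exact: h.
  by apply: bigcap_measurableType => i _; exact: measurable_coord_pair_preimage.
apply/eqP; rewrite eq_le; apply/andP; split; apply: le_measure_ae => //;
  apply: negligibleS ae_coord => x /= + xi; apply; last first.
  move=> QST; split => i iM /=; first by have [] := QST i iM.
  by have [_] := QST i iM; rewrite /= xi.
move=> [Sx Tx] i iM; split => /=; first exact: Sx.
by rewrite xi//; exact: Tx.
Qed.

Lemma measure_cylinder M S : (forall i, measurable (S i)) ->
  mu (cylinder M S) = (\prod_(i < M) gamma (S i))%E.
Proof. exact: mu_prod. Qed.

(** Each of the first [N] planes costs the factor of [gamma2_skew_lb]; the right-angle planes cost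
    nothing. The constant is therefore an [N]-th power, whatever [M] is. *)
Lemma measure_cylinder_rotation_lb (N : nat) (K : R) :
  exists2 k : R, 0 < k & forall M S T, (N <= M)%N ->
    (forall i, measurable (S i)) -> (forall i, measurable (T i)) ->
    (forall i, (i < N)%N -> S i `<=` `[- K, K]%classic) ->
    (forall i, (i < N)%N -> T i `<=` `[- K, K]%classic) ->
    (k%:E * (mu (cylinder M S) * mu (cylinder M T)) <=
     mu (cylinder M S `&` translate a (small_rotation N M) (cylinder M T)))%E.
Proof.
have cos1 : `|small_cos N| <= 1 :> R.
  have := @small_cos_sin R N; have := sqr_ge0 (small_sin N : R).
  by rewrite ler_norml => s0 cs1; apply/andP; split; nra.
have [k k0 kP] := gamma2_skew_lb K (small_sin_gt0 N) cos1.
exists (k ^+ N); first exact: exprn_gt0.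
move=> M S T NM mS mT SK TK.
rewrite measure_cylinder_rotation// !measure_cylinder//.
have -> : k ^+ N = \prod_(i < M) (if (i < N)%N then k else 1).
  rewrite -(big_mkord xpredT (fun i => if (i < N)%N then k else 1)).
  rewrite (big_cat_nat (n := N))//= [X in _ * X]big1_seq ?mulr1; last first.
    by move=> i; rewrite mem_index_iota leqNgt => /= /andP[/negbTE ->].
  rewrite big_mkord (eq_bigr (fun=> k)); last by move=> i _; rewrite ltn_ord.
  by rewrite prodr_const card_ord.
rewrite -prodEFin -!big_split/=.
(* Multiplying inequalities of extended reals needs nonnegative left-hand sides, so nonnegativity is
   carried through the induction. *)
pose le0 (x y : \bar R) := (0 <= x)%E /\ (x <= y)%E.
suff [] : le0 (\prod_(i < M) ((if (i < N)%N then k else 1)%:E *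
      (gamma (S i) * gamma (T i))))%E
    (\prod_(i < M) gamma2 (skew_rectangle (rotation_cos N i) (rotation_sin N i)
      (S i) (T i)))%E by [].
apply: (big_ind2 le0).
- by split; rewrite ?lee01.
- by move=> x1 x2 y1 y2 [? ?] [? ?]; split; [exact: mule_ge0|exact: lee_pmul].
move=> i _; split.
  by rewrite !mule_ge0// lee_fin; case: ifP => // _; exact: ltW.
rewrite /rotation_cos /rotation_sin; case: ifP => iN.
  by apply: kP => //; [exact: SK|exact: TK].
(* With cosine 0 and sine 1, the condition on [C s + D t] is one on [t] alone. *)
rewrite mul1e -(product_measure1E gamma gamma)// le_measure//.
- by rewrite inE; exact: measurableX.
- by rewrite inE; exact: measurable_skew_rectangle.
by move=> [s t] [/= Ss Tt]; split => //=; rewrite mul0r mul1r add0r.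
Qed.

End rotated_cylinders.

(* The events that a finite decision procedure, querying one of the first M
   coordinates at each step, decides. *)
Inductive decision_tree {R : realType} (M : nat) : set (Borel (Rinfty R)) -> Prop :=
| decision_true : decision_tree M setT
| decision_false : decision_tree M set0
| decision_query i (A : set (measurableTypeR R)) E F : (i < M)%N ->
    measurable A -> decision_tree M E -> decision_tree M F ->
    decision_tree M (([set x | A (x i)] `&` E) `|` ([set x | (~` A) (x i)] `&` F)).

(** * From cylinders to events of finitely many coordinates *)

Section decision_trees.
Context {R : realType}.
Implicit Types (E F : set (Borel (Rinfty R))) (S T : nat -> set (measurableTypeR R)).

Lemma measurable_decision_tree M E : decision_tree M E -> measurable E.
Proof.
elim=> // i A E1 E2 _ mA _ mE1 _ mE2.
apply: measurableU; apply: measurableI => //; apply: measurable_coord_preimage => //.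
exact: measurableC.
Qed.

Lemma widen_decision_tree M M' E : (M <= M')%N -> decision_tree M E ->
  decision_tree M' E.
Proof.
move=> MM'; elim=> [||i A E1 E2 iM mA _ t1 _ t2].
- exact: decision_true.
- exact: decision_false.
- by apply: decision_query => //; exact: leq_trans MM'.
Qed.

Lemma decision_treeC M E : decision_tree M E -> decision_tree M (~` E).
Proof.
elim=> [||i A E1 E2 iM mA _ t1 _ t2].
- by rewrite setCT; exact: decision_false.
- by rewrite setC0; exact: decision_true.
rewrite (_ : ~` _ = ([set x | A (x i)] `&` ~` E1) `|`
    ([set x | (~` A) (x i)] `&` ~` E2)); first exact: decision_query.
apply/seteqP; split => x /=.
  by have [] := pselect (A (x i)); tauto.
by tauto.
Qed.

Lemma decision_treeU M E F : decision_tree M E -> decision_tree M F ->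
  decision_tree M (E `|` F).
Proof.
move=> + tF; elim=> [||i A E1 E2 iM mA _ t1 _ t2].
- by rewrite setTU; exact: decision_true.
- by rewrite set0U.
rewrite (_ : _ `|` F = ([set x | A (x i)] `&` (E1 `|` F)) `|`
    ([set x | (~` A) (x i)] `&` (E2 `|` F))); first exact: decision_query.
apply/seteqP; split => x /=; last by tauto.
by have [] := pselect (A (x i)); tauto.
Qed.

Lemma decision_tree_cylinder M S n : (n <= M)%N -> (forall i, measurable (S i)) ->
  decision_tree M (cylinder n S).
Proof.
move=> + mS; elim: n => [_|n IHn nM].
  rewrite (_ : cylinder 0 S = setT); first exact: decision_true.
  by apply/seteqP; split => x.
rewrite (_ : cylinder n.+1 S = ([set x | S n (x n)] `&` cylinder n S) `|`
    ([set x | (~` S n) (x n)] `&` set0)).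
  by apply: decision_query => //; [exact: IHn (ltnW nM)|exact: decision_false].
rewrite setI0 setU0; apply/seteqP; split => x /=.
  by move=> h; split => [|i iN]; apply: h => //; exact: ltnW.
move=> [Sn h] i; rewrite ltnS leq_eqVlt => /orP[/eqP->//|]; exact: h.
Qed.

(** A query at [i] cuts side [i] of the cylinder in two. Iterated, this makes a tree event inside a
    cylinder a finite disjoint union of cylinders. *)
Lemma cylinder_decision_query M S i (A : set (measurableTypeR R)) E F :
  (i < M)%N ->
  cylinder M S `&`
    (([set x | A (x i)] `&` E) `|` ([set x | (~` A) (x i)] `&` F)) =
  (cylinder M (fun j => if j == i then S i `&` A else S j) `&` E) `|`
  (cylinder M (fun j => if j == i then S i `&` ~` A else S j) `&` F).
Proof.
move=> iM; apply/seteqP; split => x /=.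
  move=> [Sx [[Ax Ex]|[nAx Fx]]]; [left|right]; split => //= j jM;
    by case: eqP => [->|_]; [split => //; exact: Sx|exact: Sx].
move=> [] [Sx Ex]; have := Sx i iM; rewrite eqxx => -[_ Ax].
  split; last by left.
  by move=> j jM; have := Sx j jM; case: eqP => // -> [].
split; last by right.
by move=> j jM; have := Sx j jM; case: eqP => // -> [].
Qed.

Lemma cylinder_decision_query_disjoint M S i (A : set (measurableTypeR R)) E F :
  (i < M)%N ->
  [disjoint (cylinder M (fun j => if j == i then S i `&` A else S j) `&` E) &
  (cylinder M (fun j => if j == i then S i `&` ~` A else S j) `&` F)].
Proof.
move=> iM; apply/disj_setPS => x [[Sx _] [Sx' _]].
have := Sx i iM; have := Sx' i iM; rewrite eqxx => -[_ nAx] [_ Ax].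
exact: nAx.
Qed.

Variable mu : probability (Borel (Rinfty R)) R.
Hypothesis mu_prod : is_product_measure (normal_prob (0 : R) 1) mu.
Variable a : orthogonal_group R -> Borel (Rinfty R) -> Borel (Rinfty R).
Hypothesis mu_a : gaussian_near_action mu a.

Section box.
Variables (N M : nat) (K k : R) (g : orthogonal_group R).

Definition boxed S := (forall i, measurable (S i)) /\
  (forall i, (i < N)%N -> S i `<=` `[- K, K]%classic).

Lemma boxedI S i (A : set (measurableTypeR R)) : measurable A -> boxed S ->
  boxed (fun j => if j == i then S i `&` A else S j).
Proof.
move=> mA [mS SK]; split => j.
  by case: eqP => // _; exact: measurableI.
move=> /SK jK; case: eqP => // <-; apply: subset_trans jK; exact: subIsetl.
Qed.

(** Both sides are additive over disjoint unions in [E] and in [F], so the inequality survives such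
    unions with the same [k]. *)
Definition spread E F := (k%:E * (mu E * mu F) <= mu (E `&` translate a g F))%E.

Lemma spreadUl E1 E2 F : measurable E1 -> measurable E2 -> measurable F ->
  [disjoint E1 & E2] -> spread E1 F -> spread E2 F -> spread (E1 `|` E2) F.
Proof.
rewrite /spread => mE1 mE2 mF /disj_setPS E12 s1 s2.
have E120 : E1 `&` E2 = set0 by apply/seteqP; split.
have mtF := measurable_translate mu_a g mF.
rewrite setIUl !measureU//; [|exact: measurableI..|].
  rewrite ge0_muleDl// ge0_muleDr ?mule_ge0//; exact: leeD.
by apply/seteqP; split => x // [[x1 _] [x2 _]]; exact: (E12 x).
Qed.

Lemma spreadUr E F1 F2 : measurable E -> measurable F1 -> measurable F2 ->
  [disjoint F1 & F2] -> spread E F1 -> spread E F2 -> spread E (F1 `|` F2).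
Proof.
rewrite /spread => mE mF1 mF2 /disj_setPS F12 s1 s2.
have F120 : F1 `&` F2 = set0 by apply/seteqP; split.
have mtF1 := measurable_translate mu_a g mF1.
have mtF2 := measurable_translate mu_a g mF2.
rewrite (_ : translate a g _ = translate a g F1 `|` translate a g F2)//.
rewrite setIUr !measureU//; [|exact: measurableI..|].
  rewrite ge0_muleDr// ge0_muleDr ?mule_ge0//; exact: leeD.
apply/seteqP; split => x // [[_ x1] [_ x2]]; exact: (F12 (a g^-1%g x)).
Qed.

(** The sides [S] and [T] vary in the induction, since each answer to a query is absorbed into a
    side; shrinking a side keeps it in its box. *)
Lemma spread_decision_tree E F :
  (forall S T, boxed S -> boxed T -> spread (cylinder M S) (cylinder M T)) ->
  decision_tree M E -> decision_tree M F ->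
  forall S T, boxed S -> boxed T -> spread (cylinder M S `&` E) (cylinder M T `&` F).
Proof.
move=> cyl tE tF.
have mcyl S : boxed S -> measurable (cylinder M S).
  by move=> [mS _]; exact: measurable_cylinder.
have mI S E' : boxed S -> decision_tree M E' -> measurable (cylinder M S `&` E').
  move=> bS tE'; apply: measurableI; first exact: mcyl.
  exact: measurable_decision_tree tE'.
(* The tree of [F] is unfolded first, against a whole cylinder; the tree of [E] follows. *)
have spr S T : boxed S -> boxed T -> spread (cylinder M S) (cylinder M T `&` F).
  move=> bS; elim: tF T => [||i A F1 F2 iM mA tF1 IH1 tF2 IH2] T bT.
  - by rewrite setIT; exact: cyl.
  - by rewrite /spread setI0 measure0 !mule0.
  have b1 := boxedI i mA bT; have b2 := boxedI i (measurableC mA) bT.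
  rewrite cylinder_decision_query//; apply: spreadUr.
  - exact: mcyl.
  - exact: mI.
  - exact: mI.
  - exact: cylinder_decision_query_disjoint.
  - exact: IH1.
  - exact: IH2.
elim: tE => [||i A E1 E2 iM mA tE1 IH1 tE2 IH2] S T bS bT.
- by rewrite setIT; exact: spr.
- by rewrite /spread setI0 measure0 mul0e mule0.
have b1 := boxedI i mA bS; have b2 := boxedI i (measurableC mA) bS.
rewrite cylinder_decision_query//; apply: spreadUl.
- exact: mI.
- exact: mI.
- exact: mI.
- exact: cylinder_decision_query_disjoint.
- exact: IH1.
- exact: IH2.
Qed.

End box.

End decision_trees.

(** * Approximation of Borel sets by tree events *)

Section density.
Context {R : realType}.
Variable mu : probability (Borel (Rinfty R)) R.
Implicit Types (E F A B : set (Borel (Rinfty R))).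

(** The two halves of the symmetric difference are kept apart: the first bounds the mass lost by
    approximating, the second the error on returning to [A]. *)
Definition tree_approximable A := measurable A /\ forall e : R, 0 < e ->
  exists M E, [/\ decision_tree M E, (mu (A `\` E) <= e%:E)%E &
    (mu (E `\` A) <= e%:E)%E].

Lemma decision_tree_approximable M E : decision_tree M E -> tree_approximable E.
Proof.
move=> tE; split; first exact: measurable_decision_tree tE.
by move=> e e0; exists M, E; rewrite setDv measure0 lee_fin ltW.
Qed.

Lemma tree_approximableC A : tree_approximable A -> tree_approximable (~` A).
Proof.
move=> [mA aA]; split; first exact: measurableC.
move=> e /aA[M [E [tE AE EA]]]; exists M, (~` E); split.
- exact: decision_treeC.
- by rewrite setDE setCK setIC -setDE.
- by rewrite setDE setCK setIC -setDE.
Qed.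

Lemma le_measureD2 A B A' B' (x y : \bar R) :
  measurable A -> measurable B -> measurable A' -> measurable B' ->
  (mu (A `\` A') <= x)%E -> (mu (B `\` B') <= y)%E ->
  (mu ((A `|` B) `\` (A' `|` B')) <= x + y)%E.
Proof.
move=> mA mB mA' mB' Ax By.
have mAA : measurable (A `\` A') by exact: measurableD.
have mBB : measurable (B `\` B') by exact: measurableD.
apply: (@le_trans _ _ (mu ((A `\` A') `|` (B `\` B')))).
  apply: le_measure; rewrite ?inE.
  - by apply: measurableD; exact: measurableU.
  - exact: measurableU.
  by move=> t [[At|Bt] /not_orP[nA nB]]; [left|right].
by apply: (le_trans (measureU2 _ mAA mBB)); exact: leeD.
Qed.

Lemma tree_approximableU A B : tree_approximable A -> tree_approximable B ->
  tree_approximable (A `|` B).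
Proof.
move=> [mA aA] [mB aB]; split; first exact: measurableU.
move=> e e0; have e2 : 0 < e / 2 by rewrite divr_gt0.
have [M [E [tE AE EA]]] := aA _ e2; have [M' [F [tF BF FB]]] := aB _ e2.
have mE := measurable_decision_tree tE; have mF := measurable_decision_tree tF.
have eD : e%:E = ((e / 2)%:E + (e / 2)%:E)%E by rewrite -EFinD -splitr.
exists (maxn M M'), (E `|` F); split.
- apply: decision_treeU.
    exact: widen_decision_tree (leq_maxl _ _) tE.
  exact: widen_decision_tree (leq_maxr _ _) tF.
- by rewrite eD; exact: le_measureD2.
- by rewrite eD; exact: le_measureD2.
Qed.

(** Since [mu] is finite, what the finite unions miss tends to 0: half of [e] pays for that, half
    for approximating a finite union. *)
Lemma tree_approximable_bigcup (A : nat -> set (Borel (Rinfty R))) :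
  (forall n, tree_approximable (A n)) -> tree_approximable (\bigcup_n A n).
Proof.
move=> aA; have mA n : measurable (A n) by have [] := aA n.
pose U n := \big[setU/set0]_(k < n) A k.
have aU n : tree_approximable (U n).
  rewrite /U; elim: n => [|n IHn].
    by rewrite big_ord0; apply: (@decision_tree_approximable 0); exact: decision_false.
  by rewrite big_ord_recr /=; exact: tree_approximableU.
have mU : measurable (\bigcup_n A n) by exact: bigcupT_measurable.
split=> // e e0; have e2 : 0 < e / 2 by rewrite divr_gt0.
have cvgU : mu (\bigcup_n A n `\` U n) @[n --> \oo] --> mu set0.
  rewrite (_ : set0 = \bigcap_n (\bigcup_n A n `\` U n)); last first.
    apply/esym; rewrite -subset0 => t /= h; have [[n _ An] _] := h 0%N I.
    have [_] := h n.+1 I; apply; rewrite /U big_ord_recr/=; by right.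
  apply: nonincreasing_cvg_mu.
  - rewrite -ge0_fin_numE// fin_num_measure//; apply: measurableD => //.
    by have [] := aU 0%N.
  - by move=> n; apply: measurableD => //; have [] := aU n.
  - by apply: bigcapT_measurable => n; apply: measurableD => //; have [] := aU n.
  - move=> m n mn; apply/subsetPset; apply: setDS; exact: subset_bigsetU.
rewrite measure0 in cvgU.
have : \forall n \near \oo, (mu (\bigcup_n A n `\` U n) < (e / 2)%:E)%E.
  have : nbhs (0%E : \bar R) [set y | (y < (e / 2)%:E)%E].
    by apply: open_nbhs_nbhs; split; [exact: open_ereal_lt_ereal|rewrite /= lte_fin].
  exact: cvgU.
move=> [n _ /(_ n (leqnn n)) /= /ltW UAn].
have [mUn /(_ _ e2)[M [E [tE UE EU]]]] := aU n.
have mE := measurable_decision_tree tE.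
have UnU : U n `<=` \bigcup_n A n.
  by rewrite /U -bigcup_mkord => t [j _ Aj]; exists j.
exists M, E; split => //.
  have m1 : measurable (\bigcup_n A n `\` U n) by exact: measurableD.
  have m2 : measurable (U n `\` E) by exact: measurableD.
  apply: (@le_trans _ _ (mu ((\bigcup_n A n `\` U n) `|` (U n `\` E)))).
    apply: le_measure; rewrite ?inE; [exact: measurableD|exact: measurableU|].
    move=> t [At nE]; have [Ut|nUt] := pselect (U n t); last by left.
    by right.
  rewrite [e]splitr EFinD; apply: (le_trans (measureU2 _ m1 m2)); exact: leeD.
apply: (@le_trans _ _ (mu (E `\` U n))).
  apply: le_measure; rewrite ?inE; [exact: measurableD|exact: measurableD|].
  by apply: setDS.
by apply: (le_trans EU); rewrite lee_fin; lra.
Qed.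

(** Finite lists of rational endpoints keep the family countable. *)
Definition rational_box (s : seq (rat * rat)) : set (Borel (Rinfty R)) :=
  cylinder (size s) (fun i =>
    `]ratr (nth (0, 0) s i).1, ratr (nth (0, 0) s i).2[%classic).

(** Points [e]-close to [x] in the first [n] coordinates form a filter base converging to [x]
    pointwise, so some such set lies in [U]. Rational endpoints within [e] of each [x i], one on
    either side, give a smaller box. *)
Lemma nbhs_rational_box (U : set (Rinfty R)) (x : Rinfty R) : nbhs x U ->
  exists s, rational_box s x /\ rational_box s `<=` U.
Proof.
pose B (ne : nat * R) := [set y : {ptws nat -> R} |
  forall i, (i < ne.1)%N -> `|x i - y i| < ne.2].
pose F : set_system {ptws nat -> R} := filter_from [set ne : nat * R | 0 < ne.2] B.
have FF : Filter F.
  apply: filter_from_filter; first by exists (0%N, 1) => /=.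
  move=> [n e] [m d] /= e0 d0; exists (maxn n m, Order.min e d).
    by rewrite /= lt_min e0.
  move=> y By; split=> i iN; have /= := By i.
    by rewrite leq_max iN /= lt_min => /(_ isT)/andP[].
  by rewrite leq_max iN orbT lt_min => /(_ isT)/andP[].
have : F --> (x : {ptws nat -> R}).
  apply/(@pointwise_cvgP nat R F x) => i; apply/cvgrPdist_lt => e e0.
  by exists (i.+1, e) => //= y; apply.
move=> Fx /Fx[[n e] /= e0 nU].
have /choice[p pP] (i : nat) : exists p : rat * rat,
    [/\ ratr p.1 \in `](x i - e), (x i)[ & ratr p.2 \in `](x i), (x i + e)[].
  have [|q1 q1P] := @rat_in_itvoo R (x i - e) (x i); first by rewrite ltrBlDr ltrDl.
  have [|q2 q2P] := @rat_in_itvoo R (x i) (x i + e); first by rewrite ltrDl.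
  by exists (q1, q2).
exists (mkseq p n); split.
  move=> i; rewrite size_mkseq => iN; rewrite /= nth_mkseq// in_itv /=.
  by have [] := pP i; rewrite !in_itv /= => /andP[_ ->] /andP[->].
move=> y py; apply: nU => i /= iN; have := py i; rewrite size_mkseq nth_mkseq//.
move=> /(_ iN); have [] := pP i.
rewrite /= !in_itv /= => /andP[? ?] /andP[? ?] /andP[? ?].
rewrite ltr_norml; apply/andP; split; lra.
Qed.

(** An open set is the union of the rational boxes inside it, enumerated by decoding natural
    numbers; all other codes give the empty set. *)
Lemma open_tree_approximable (U : set (Rinfty R)) : open U -> tree_approximable U.
Proof.
move=> oU; pose B (o : option (seq (rat * rat))) :=
  if o is Some s then if `[< rational_box s `<=` U >] then rational_box s else set0
  else set0.
have aB o : tree_approximable (B o).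
  have a0 : tree_approximable set0.
    by apply: (@decision_tree_approximable 0); exact: decision_false.
  case: o => [s|] //; rewrite /B; case: asboolP => // _.
  apply: (decision_tree_approximable (M := size s)).
  exact: decision_tree_cylinder.
rewrite (_ : U = \bigcup_n B (unpickle n)).
  by apply: tree_approximable_bigcup => n; exact: aB.
apply/seteqP; split => x.
  move=> Ux; have [s [sx sU]] := nbhs_rational_box (open_nbhs_nbhs (conj oU Ux)).
  by exists (pickle s) => //; rewrite pickleK /B; case: asboolP.
move=> [n _]; case: (unpickle n) => // s; rewrite /B; case: asboolP => // sU.
exact: sU.
Qed.

(** The approximable sets form a sigma-algebra containing the open sets. *)
Lemma measurable_tree_approximable A : measurable A -> tree_approximable A.
Proof.
move: A; apply: smallest_sub; last exact: open_tree_approximable.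
split.
- by apply: (@decision_tree_approximable 0); exact: decision_false.
- by move=> A aA; rewrite setTD; exact: tree_approximableC.
- exact: tree_approximable_bigcup.
Qed.

End density.

(** * Truncation of the first coordinates to a bounded box *)

Section bounded_coordinates.
Context {R : realType}.
Variable mu : probability (Borel (Rinfty R)) R.
Implicit Types (A B E : set (Borel (Rinfty R))) (K : R).

Definition box_sides N K (i : nat) : set (measurableTypeR R) :=
  if (i < N)%N then `[- K, K]%classic else setT.

Lemma boxed_box_sides N K : boxed N K (box_sides N K).
Proof.
split=> i; last by rewrite /box_sides => ->.
by rewrite /box_sides; case: ifP.
Qed.

Lemma cylinder_box_sides N M K : (N <= M)%N ->
  cylinder M (box_sides N K) = cylinder N (box_sides N K).
Proof.
move=> NM; apply/seteqP; split => x Sx i iN; first by apply: Sx; exact: leq_trans NM.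
by have := Sx i; rewrite /box_sides; case: ifP => // _; exact.
Qed.

Lemma measurable_box N K : measurable (cylinder N (box_sides N K)).
Proof. by apply: measurable_cylinder; have [] := boxed_box_sides N K. Qed.

Lemma subset_box N K K' : K <= K' ->
  cylinder N (box_sides N K) `<=` cylinder N (box_sides N K').
Proof.
move=> KK' x Sx i iN; have := Sx i iN; rewrite /box_sides iN /= !in_itv /=.
by move=> /andP[? ?]; apply/andP; split; lra.
Qed.

Lemma bigcup_box N : \bigcup_n cylinder N (box_sides N n%:R) = [set: Borel (Rinfty R)].
Proof.
apply/seteqP; split => // x _.
have [n nP] : exists n, forall i, (i < N)%N -> `|x i| <= n%:R.
  elim: N => [|N [n nP]]; first by exists 0%N.
  exists (maxn n (Num.bound `|x N|)) => i; rewrite ltnS leq_eqVlt => /orP[/eqP->|iN].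
    by apply/ltW/(lt_le_trans (archi_boundP _)) => //; rewrite ler_nat leq_maxr.
  by apply: (le_trans (nP i iN)); rewrite ler_nat leq_maxl.
by exists n => // i iN; rewrite /box_sides iN /= in_itv /= -ler_norml nP.
Qed.

(** The boxes exhaust the space; if all of them met [A] in null sets, [A] would be null. *)
Lemma measure_box_gt0 N A : measurable A -> (0 < mu A)%E ->
  exists n : nat, (0 < mu (cylinder N (box_sides N n%:R) `&` A))%E.
Proof.
move=> mA A0; apply/not_existsP => h.
suff : mu A = 0%E by move=> A00; rewrite A00 ltxx in A0.
have : mu.-negligible (\bigcup_n (cylinder N (box_sides N n%:R) `&` A)).
  apply: negligible_bigcup => n; apply/negligibleP.
    by apply: measurableI => //; exact: measurable_box.
  by apply/eqP; rewrite eq_le measure_ge0 andbT leNgt; apply/negP; exact: h.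
by rewrite -setI_bigcupl bigcup_box setTI => /negligibleP; apply.
Qed.

End bounded_coordinates.

(** * Choice of the constants and final estimate *)

Theorem theorem4p1 (R : realType) (mu : probability (Borel (Rinfty R)) R)
    (a : orthogonal_group R -> Borel (Rinfty R) -> Borel (Rinfty R)) :
  is_product_measure (normal_prob (0%R : R) 1%R) mu ->
  gaussian_near_action mu a ->
  whirly mu a.
Proof.
move=> mu_prod mu_a A B mA mB A0 B0 U U1.
have [N NU] := nbhs1_small_rotation U1.
have [K [AK0 BK0]] : exists K : R,
    (0 < mu (cylinder N (box_sides N K) `&` A))%E /\
    (0 < mu (cylinder N (box_sides N K) `&` B))%E.
  have [n An] := measure_box_gt0 N mA A0; have [m Bm] := measure_box_gt0 N mB B0.
  exists (maxn n m)%:R; split.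
    apply: (lt_le_trans An); apply: le_measure; rewrite ?inE.
    - by apply: measurableI => //; exact: measurable_box.
    - by apply: measurableI => //; exact: measurable_box.
    by apply: setSI; apply: subset_box; rewrite ler_nat leq_maxl.
  apply: (lt_le_trans Bm); apply: le_measure; rewrite ?inE.
  - by apply: measurableI => //; exact: measurable_box.
  - by apply: measurableI => //; exact: measurable_box.
  by apply: setSI; apply: subset_box; rewrite ler_nat leq_maxr.
set Q := cylinder N (box_sides N K) in AK0 BK0.
have mQ : measurable Q by exact: measurable_box.
(* [k] is fixed by [N] and [K]; the error [e], then the approximations, and at last [M] are chosen
   after it. *)
have [k k0 kP] := measure_cylinder_rotation_lb mu_prod mu_a N K.
have mQA : measurable (Q `&` A) by exact: measurableI.
have mQB : measurable (Q `&` B) by exact: measurableI.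
pose al := fine (mu (Q `&` A)); pose be := fine (mu (Q `&` B)).
have alE : mu (Q `&` A) = al%:E by rewrite fineK// fin_num_measure.
have beE : mu (Q `&` B) = be%:E by rewrite fineK// fin_num_measure.
have al0 : 0 < al by rewrite -lte_fin -alE.
have be0 : 0 < be by rewrite -lte_fin -beE.
(* The first two bounds give [al - e >= al / 2] and [be - e >= be / 2], hence mass at least
   [k al be / 4] for the approximating intersection; the third keeps the total error [2 e] within
   half of that. *)
pose e := Order.min (Order.min (al / 2) (be / 2)) (k * al * be / 16).
have e0 : 0 < e by rewrite !lt_min !divr_gt0 ?mulr_gt0.
have eal : e <= al / 2 by rewrite !ge_min lexx.
have ebe : e <= be / 2 by rewrite !ge_min lexx orbT.
have ek : e <= k * al * be / 16 by rewrite !ge_min lexx orbT.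
have [_ /(_ e e0)[M1 [A' [tA' AA' A'A]]]] := measurable_tree_approximable mu mA.
have [_ /(_ e e0)[M2 [B' [tB' BB' B'B]]]] := measurable_tree_approximable mu mB.
have mA' := measurable_decision_tree tA'; have mB' := measurable_decision_tree tB'.
pose M := maxn N (maxn M1 M2).
have NM : (N <= M)%N by exact: leq_maxl.
have {}tA' : decision_tree M A'.
  by apply: widen_decision_tree tA'; rewrite !leq_max leqnn orbT.
have {}tB' : decision_tree M B'.
  by apply: widen_decision_tree tB'; rewrite !leq_max leqnn !orbT.
pose g : orthogonal_group R := small_rotation N M; exists g; first exact: NU.
have lb (C C' : set (Borel (Rinfty R))) (c : R) : measurable C -> measurable C' ->
    mu (Q `&` C) = c%:E -> (mu (C `\` C') <= e%:E)%E ->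
    ((c - e)%:E <= mu (Q `&` C'))%E.
  move=> mC mC' cE CC'; rewrite EFinB leeBlDr// -cE.
  have mQC' : measurable (Q `&` C') by exact: measurableI.
  have mCC' : measurable (C `\` C') by exact: measurableD.
  apply: (@le_trans _ _ (mu ((Q `&` C') `|` (C `\` C')))).
    apply: le_measure; rewrite ?inE; [exact: measurableI|exact: measurableU|].
    move=> x [Qx Cx]; have [C'x|nC'x] := pselect (C' x); first by left.
    by right.
  by apply: (le_trans (measureU2 _ mQC' mCC')); exact: leeD.
have lbA := lb _ _ _ mA mA' alE AA'; have lbB := lb _ _ _ mB mB' beE BB'.
have bQ := boxed_box_sides N K.
have spr : (k%:E * (mu (Q `&` A') * mu (Q `&` B')) <=
    mu ((Q `&` A') `&` translate a g (Q `&` B')))%E.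
  have cyl S T : boxed N K S -> boxed N K T ->
      spread mu a k g (cylinder M S) (cylinder M T).
    by move=> [mS SK] [mT TK]; exact: kP.
  have := spread_decision_tree mu_a cyl tA' tB' bQ bQ.
  (* Only the first [N] sides of the box are constrained, so its cylinders of length [M] and [N]
     coincide. *)
  by rewrite !(cylinder_box_sides _ NM).
have spr2 : ((k * ((al - e) * (be - e)))%:E <=
    mu ((Q `&` A') `&` translate a g (Q `&` B')))%E.
  apply: le_trans spr; rewrite EFinM lee_pmul2l// EFinM.
  by apply: lee_pmul => //; rewrite lee_fin; lra.
have mtB := measurable_translate mu_a g mB.
have mAB : measurable (A `&` translate a g B) by exact: measurableI.
have mAA : measurable (A' `\` A) by exact: measurableD.
have mBB : measurable (B' `\` B) by exact: measurableD.
have mtBB := measurable_translate mu_a g mBB.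
(* A point [x] of the left-hand event lies in [A' \ A] if it is outside [A], and in the translate of
   [B' \ B] if [g^-1 x] is outside [B]. Each exceptional set has measure at most [e], the second
   because the action preserves [mu]. *)
have ub : (mu ((Q `&` A') `&` translate a g (Q `&` B')) <=
    mu (A `&` translate a g B) + (e%:E + e%:E))%E.
  apply: (@le_trans _ _ (mu ((A `&` translate a g B) `|`
      ((A' `\` A) `|` translate a g (B' `\` B))))).
    apply: le_measure; rewrite ?inE.
    - apply: measurableI; first exact: measurableI.
      by apply: (measurable_translate mu_a); exact: measurableI.
    - by apply: measurableU => //; exact: measurableU.
    move=> x [[_ A'x] [_ B'x]].
    have [Ax|nAx] := pselect (A x); last by right; left.
    by have [Bx|nBx] := pselect (B (a (g^-1)%g x)); [left|right; right].
  apply: (le_trans (measureU2 _ mAB _)); first exact: measurableU.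
  apply: leeD => //; apply: (le_trans (measureU2 _ mAA mtBB)); apply: leeD => //.
  apply: le_trans B'B; rewrite le_eqVlt; apply/orP; left; apply/eqP.
  exact: (measure_translate mu_a g mBB).
have := le_trans spr2 ub; rewrite -(@fineK _ (mu (A `&` _))) ?fin_num_measure//.
rewrite -!EFinD lee_fin lte_fin => h.
have := mulr_gt0 k0 (mulr_gt0 al0 be0).
have : (al / 2) * (be / 2) <= (al - e) * (be - e).
  by apply: ler_pM; lra.
move=> /(ler_wpM2l (ltW k0)) hk kab.
have : k * (al / 2 * (be / 2)) = k * al * be / 4 by field.
lra.
Qed.
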